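(* Let $a,b\in\mathbb{R}$ with $b\neq 0$. Let $f:\mathbb{R}\to\mathbb{R}$ be nontrivial (not vanishing identically) with $f\in L^2(\mathbb{R})$, and let $\mathcal{K}:\mathbb{R}\to\mathbb{R}$ be not identically zero with $\mathcal{K}\in L^1(\mathbb{R})$. Let $M>0$, and for $j=1,2$ let $g_j:\mathbb{R}\to\mathbb{R}$ be a function, not identically zero, with $g_j(0)=0$, $g_j'\in L^\infty(\mathbb{R})$ and $\|g_j'\|_{L^\infty(\mathbb{R})}\le M$. Let $0<\rho\le 1$, let $u_0\in L^2(\mathbb{R})$ be the unique solution in $L^2(\mathbb{R})$ of $$\Big[\tfrac12\ln\Big(-\frac{d^2}{dx^2}\Big)\Big]u_0-b\frac{du_0}{dx}-au_0=f(x),\qquad x\in\mathbb{R},$$ and suppose $$0<\varepsilon\le\frac{\rho\, C_{a,b}}{M\|\mathcal{K}\|_{L^1(\mathbb{R})}\,(\|u_0\|_{L^2(\mathbb{R})}+1)}.$$ For $j=1,2$ let $u_{p,j}$ be the unique fixed point of the map $t_{g_j}:B_\rho\to B_\rho$, and let $u_j:=u_0+u_{p,j}$ be the resulting solution of $$\Big[-\tfrac12\ln\Big(-\frac{d^2}{dx^2}\Big)\Big]u+b\frac{du}{dx}+au+f(x)+\varepsilon\int_{-\infty}^{\infty}\mathcal{K}(x-y)\,g_j(u(y))\,dy=0.$$ Set $\sigma:=\dfrac{\varepsilon M\|\mathcal{K}\|_{L^1(\mathbb{R})}}{C_{a,b}}$. Then $$\|u_1-u_2\|_{L^2(\mathb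b{R})}\le\frac{\varepsilon}{1-\sigma}\,\frac{\|\mathcal{K}\|_{L^1(\mathbb{R})}}{C_{a,b}}\,(\|u_0\|_{L^2(\mathbb{R})}+1)\,\|g_1'-g_2'\|_{L^\infty(\mathbb{R})}.$$
   Context: Functions in $L^2(\mathbb{R})$ are real-valued here. The Fourier transform is $\widehat{\phi}(p)=\frac{1}{\sqrt{2\pi}}\int_{-\infty}^\infty\phi(x)e^{-ipx}dx$ (extended to $L^2(\mathbb{R})$ as usual). The logarithmic Laplacian $\ln(-\frac{d^2}{dx^2})$ is the operator with Fourier symbol $2\ln|p|$. Hence the operator $L_{a,b}:=\frac12\ln(-\frac{d^2}{dx^2})-b\frac{d}{dx}-a$, considered on $L^2(\mathbb{R})$, has Fourier symbol $$\lambda_{a,b}(p)=\ln\Big(\frac{|p|}{e^a}\Big)-ibp.$$ A function $u\in L^2(\mathbb{R})$ is a solution of $L_{a,b}u=h$, with $h\in L^2(\mathbb{R})$, if $\lambda_{a,b}(p)\widehat{u}(p)=\widehat{h}(p)$ for a.e. $p\in\mathbb{R}$. Since $b\ne0$, $|\lambda_{a,b}(p)|=\sqrt{\ln^2(|p|/e^a)+b^2p^2}$ is bounded below by a positive constant; $C_{a,b}>0$ denotes a fixed constant, depending only on $a,b$, with $|\lambda_{a,b}(p)|\ge C_{a,b}$ for all $p\in\mathbb{R}\setminus\{0\}$. For every $f\in L^2(\mathbb{R})$ the equation $L_{a,b}u_0=f$ has a unique solution $u_0\in L^2(\mathbb{R})$. The condition $g_j'\in L^\infty(\mathbb{R})$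 is understood so that $g_j$ is recovered from its derivative: $g_j$ is locally absolutely continuous and $g_j(s)-g_j(t)=\int_t^s g_j'(z)\,dz$ for all $s,t\in\mathbb{R}$. $B_\rho:=\{u\in L^2(\mathbb{R}) : \|u\|_{L^2(\mathbb{R})}\le\rho\}$. For $g=g_1$ or $g=g_2$ and $v\in B_\rho$, $t_g v$ denotes the unique solution $u\in B_\rho$ of $$\Big[\tfrac12\ln\Big(-\frac{d^2}{dx^2}\Big)\Big]u-b\frac{du}{dx}-au=\varepsilon\int_{-\infty}^{\infty}\mathcal{K}(x-y)\,g(u_0(y)+v(y))\,dy.$$ Under the stated condition on $\varepsilon$, the map $t_g:B_\rho\to B_\rho$ is well defined and is a strict contraction in the $L^2(\mathbb{R})$ norm, so it has a unique fixed point. *)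

(* Defs.v *)
From HB Require Import structures.
From mathcomp Require Import all_boot all_order all_algebra.
From mathcomp Require Import all_classical all_reals all_analysis.
From mathcomp Require Export complex.

Set Implicit Arguments.
Unset Strict Implicit.
Unset Printing Implicit Defensive.

Import Order.TTheory GRing.Theory Num.Theory.
Import numFieldNormedType.Exports.

Local Open Scope classical_set_scope.
Local Open Scope ring_scope.
Local Open Scope complex_scope.

Section LogLaplacian.
Context {R : realType}.
Implicit Types (a b eps rho C M : R) (u v f h g K : R -> R) (psi : R -> R[i]).

Local Notation mu := (@lebesgue_measure R).

Definition Lp (p : \bar R) : {pred R -> R} := Lfun mu p.

Definition norm_Lp (p : \bar R) u : \bar R := 'N[mu]_p[EFin \o u].

Definition cmod (z : R[i]) : R := ComplexField.Normc.normc z.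

Definition in_L2C psi : Prop :=
  (fun p => complex.Re (psi p)) \in Lp 2%:E /\ (fun p => complex.Im (psi p)) \in Lp 2%:E.

(* (2 pi)^(-1/2) \int u(x) e^(-ipx) dx, with e^(-ipx) = cos(px) - i sin(px);
   meaningful for u in L^1. *)
Definition fourier_L1 u (p : R) : R[i] :=
  ((Num.sqrt (2 * pi))^-1)%:C *
  ((\int[mu]_x (u x * cos (p * x))) -i* (\int[mu]_x (u x * sin (p * x))))%R.

Definition truncate (n : nat) u : R -> R :=
  fun x => u x * \1_(`[- n%:R, n%:R]%classic : set R) x.

(* psi is the Fourier transform of u in L^2(R): the limit in L^2(R; C) of the
   integral transforms of the truncations of u, which lie in L^1 and L^2.
   This determines psi up to a null set. *)
Definition is_fourier u psi : Prop :=
  [/\ u \in Lp 2%:E, in_L2C psi &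
   (fun n : nat =>
      \int[mu]_p (cmod (fourier_L1 (truncate n u) p - psi p) ^+ 2)%:E)%E
     @ \oo --> 0%E].

(* Fourier symbol of L_{a,b} = (1/2) ln(- d^2/dx^2) - b d/dx - a, at p <> 0. *)
Definition symbol a b (p : R) : R[i] := ln (`|p| / expR a) -i* (b * p).

(* L_{a,b} u = h, read through Fourier transforms. *)
Definition is_solution a b h u : Prop :=
  [/\ u \in Lp 2%:E, h \in Lp 2%:E &
   exists uhat hhat : R -> R[i],
     [/\ is_fourier u uhat, is_fourier h hhat &
         {ae mu, forall p, symbol a b p * uhat p = hhat p}]].

(* At the points where the integral is not absolutely convergent the value is
   unspecified; for K in L^1 and w in L^2 these form a null set. *)
Definition convolution K (w : R -> R) (x : R) : R :=
  (\int[mu]_y (K (x - y) * w y))%R.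

Definition ball_L2 rho u : Prop :=
  u \in Lp 2%:E /\ (norm_Lp 2%:E u <= rho%:E)%E.

(* The graph {(v, u) | u = t_g v} of the map t_g. *)
Definition t_graph a b eps rho K u0 g v u : Prop :=
  [/\ ball_L2 rho v, ball_L2 rho u &
   is_solution a b
     (fun x => eps * convolution K (fun y => g (u0 y + v y)) x) u].

Definition fixed_point_t a b eps rho K u0 g v : Prop :=
  t_graph a b eps rho K u0 g v v.

(* g' is in L^oo and g is the indefinite integral of g'; the integral formula
   for a bounded g' makes g Lipschitz, hence locally absolutely continuous.
   Restricting to t <= s loses nothing, as the formula is antisymmetric in
   (s, t). *)
Definition bounded_derivative g : Prop :=
  [/\ {ae mu, forall x, derivable g x 1},
      (derive1 g) \in Lp +oo%E &
      forall t s : R, t <= s -> g s - g t = (\int[mu]_(z in `[t, s]) derive1 g z)%R].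

End LogLaplacian.

(* Main.v *)
Require Import Defs.
From HB Require Import structures.
From mathcomp Require Import all_boot all_order all_algebra.
From mathcomp Require Import all_classical all_reals all_analysis.
From mathcomp Require Import measurable_realfun ess_sup_inf.
From mathcomp Require Import ring lra.

Import Order.TTheory GRing.Theory Num.Theory.
Import numFieldNormedType.Exports.

Local Open Scope classical_set_scope.
Local Open Scope ring_scope.

(** The difference of the two fixed points solves the linear equation with
    right-hand side eps K * (g1 (u1) - g2 (u2)).  In Fourier variables the
    equation is multiplication by a symbol of modulus at least C, so that by
    Plancherel ([solution_stability]) and Young ([young_convolution])
      || u1 - u2 || <= (eps ||K||_1 / C) || g1 (u1) - g2 (u2) ||.
    The derivatives bound the increments of g1 and of g1 - g2, and g1 - g2
    vanishes at 0, whence pointwise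
      | g1 (u1) - g2 (u2) | <= M | u1 - u2 | + || g1' - g2' ||_oo | u2 |,
    and || u2 || <= || u0 || + rho <= || u0 || + 1.  Altogether
      || u1 - u2 || <= sigma || u1 - u2 ||
         + (eps ||K||_1 / C) (|| u0 || + 1) || g1' - g2' ||_oo,
    and the first term on the right can be absorbed because sigma < 1.  The
    bound on eps gives sigma <= rho / (|| u0 || + 1) with rho <= 1, which is less
    than 1 as u0 does not vanish; this is where f <> 0 enters ([solution_neq0]).

    The substantial part is Plancherel's theorem.  For an integrable u let c, s
    be its cosine and sine transforms.  Weighting with exp (- e |p|), whose
    cosine transform is 2 pi times the Poisson kernel, and applying Fubini gives
      int exp (- e |p|) (c^2 + s^2) dp
         = int int u (x) u (y) 2 e / (e^2 + (x - y)^2) dx dy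
    ([integral_abel_power]).
    - Since the kernel is nonnegative of mass 2 pi and 2 |a b| <= a^2 + b^2, the
      right-hand side is at most 2 pi int u^2; letting e tend to 0 gives Bessel's
      inequality ([bessel]).
    - If u is bounded, and continuous where it does not vanish, the Poisson
      averages converge to u at these points, which gives equality
      ([plancherel_ge]).
    - Bessel's defect 2 pi int u^2 - int (c^2 + s^2) is a nonnegative quadratic
      form; it vanishes on a dense set ([L2_dense]) and is controlled by the L2
      norm, so it vanishes for every square integrable u with bounded support
      ([plancherel_compact]).
    The isometry then passes to the L2 limit that defines the Fourier transform
    ([plancherel]). *)

(** * Affine changes of variables in the Lebesgue integral *)

Section affine.
Context {R : realType}.
Notation mu := (@lebesgue_measure R).

Let aff (c d : R) : measurableTypeR R -> measurableTypeR R := fun x => c * x + d.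

Let maff c d : measurable_fun [set: measurableTypeR R] (aff c d).
Proof. by apply: measurable_funD => //; exact: measurable_funM. Qed.

(** The pushforward of Lebesgue measure under x |-> c x + d, rescaled by |c|; it
    has the same values as Lebesgue measure on half-open intervals, hence
    coincides with it. *)
Let nu (c d : R) : {measure set (measurableTypeR R) -> \bar R}.
Proof.
refine (mscale (NngNum (normr_ge0 c)) (pushforward mu (aff c d))).
exact: maff.
Defined.

Let nuE (c d : R) (A : set R) : c != 0 -> measurable A ->
  (mu A = nu c d A)%E.
Proof.
move=> c0 mA.
rewrite (@lebesgue_measure_unique R (nu c d))// => _ [[a b] _ <-].
have [cp|cn|ce] := ltgtP 0 c; last by rewrite -ce eqxx in c0.
- transitivity (`|c|%:E * mu (`](a - d) / c, (b - d) / c]%classic)%R)%E; last first.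
    congr (_ * mu _)%E; apply/seteqP; split => x /=;
    by rewrite /aff !in_itv/= ltr_pdivrMr// ler_pdivlMr// ltrBlDr lerBrDr (mulrC x).
  rewrite !lebesgue_measure_itv/= !lte_fin ltr_pM2r ?invr_gt0// ltrD2r.
  by case: ifP => _; rewrite ?mule0// -!EFinB -EFinM gtr0_norm//; congr EFin; field.
- transitivity (`|c|%:E * mu (`[(b - d) / c, (a - d) / c[%classic)%R)%E; last first.
    congr (_ * mu _)%E; apply/seteqP; split => x /=;
    by rewrite /aff !in_itv/= ltr_ndivlMr// ler_ndivrMr// ltrBlDr lerBrDr (mulrC x) andbC.
  rewrite !lebesgue_measure_itv/= !lte_fin ltr_nM2r ?invr_lt0// ltrD2r.
  by case: ifP => _; rewrite ?mule0// -!EFinB -EFinM ltr0_norm//; congr EFin; field.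
Qed.

Lemma ge0_integral_affine (c d : R) (f : R -> \bar R) : c != 0 ->
  measurable_fun setT f -> (forall x, 0 <= f x)%E ->
  (\int[mu]_x f x = `|c|%:E * \int[mu]_x f (c * x + d)%R)%E.
Proof.
move=> c0 mf f0.
rewrite (eq_measure_integral (nu c d)); last by move=> A mA _; exact: nuE.
rewrite ge0_integral_mscale//=; congr (_ * _)%E.
by rewrite ge0_integral_pushforward.
Qed.

Lemma integral_affine (c d : R) (f : R -> \bar R) : c != 0 ->
  measurable_fun setT f ->
  mu.-integrable setT (fun x => f (c * x + d)) ->
  (\int[mu]_x f x = `|c|%:E * \int[mu]_x f (c * x + d)%R)%E.
Proof.
move=> c0 mf intf.
rewrite [LHS]integralE [in X in (_ * X)%E]integralE muleBr//.
  congr (_ - _)%E.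
  rewrite (ge0_integral_affine c d (f^\+)%E c0 (measurable_funepos mf) (funepos_ge0 f)).
    congr (_ * _)%E; apply: eq_integral => x _.
    by rewrite !unlock.
  rewrite (ge0_integral_affine c d (f^\-)%E c0 (measurable_funeneg mf) (funeneg_ge0 f)).
    congr (_ * _)%E; apply: eq_integral => x _.
    by rewrite !unlock.
by apply: fin_num_adde_defr; apply: integrable_pos_fin_num.
Qed.
End affine.

(** * Abel weights and the Poisson kernel *)

Section poisson.
Context {R : realType}.
Notation mu := (@lebesgue_measure R).

(** The cosine transform of the weight [abel e]; it is 2 pi times the Poisson kernel
    of the half-plane at height e. *)
Definition poisson (e t : R) : R := 2 * e / (e ^+ 2 + t ^+ 2).

(** The weight of Abel's summation method: integrable for e > 0, and increasing to 1
    as e decreases to 0. *)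
Definition abel (e p : R) : R := expR (- (e * `|p|)).

(** An antiderivative of exp (- e p) (1 + cos (p t)).  The summand 1 makes the
    integrand nonnegative, so that the fundamental theorem of calculus applies on a
    half-line without a prior proof of integrability; it is removed afterwards by
    comparison with the case t = 0. *)
Let F (e t p : R) : R :=
  expR (- (e * p)) * (- e^-1 + (t * sin (p * t) - e * cos (p * t)) / (e ^+ 2 + t ^+ 2)).

Let dF (e t p : R) : 0 < e ->
  is_derive p 1 (F e t) (expR (- (e * p)) * (1 + cos (p * t))).
Proof.
move=> e0; rewrite /F.
apply: is_derive_eq.
have e2 : e ^+ 2 + t ^+ 2 != 0 by rewrite gt_eqF// ltr_wpDr ?sqr_ge0// exprn_gt0.
rewrite /GRing.scale/=; field.
by rewrite e2 gt_eqF.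
Qed.

Let Fy (e t : R) : 0 < e -> F e t p @[p --> +oo] --> 0.
Proof.
move=> e0; rewrite /F.
have e2 : 0 < e ^+ 2 + t ^+ 2 by rewrite ltr_wpDr ?sqr_ge0// exprn_gt0.
pose M := e^-1 + (`|t| + e) / (e ^+ 2 + t ^+ 2).
have cE : (expR (- (e * p)) @[p --> +oo] --> (0 : R)).
  apply: (cvg_comp (fun p => e * p) (fun p => expR (- p))); last exact: cvgr_expR.
  exact: gt0_cvgMry.
apply: norm_cvg0.
apply: (@squeeze_cvgr _ _ _ _ (cst 0) (fun p => expR (- (e * p)) * M)).
- apply: nearW => p; rewrite normr_ge0/= normrM ger0_norm ?expR_ge0//.
  rewrite ler_wpM2l ?expR_ge0// (le_trans (ler_normD _ _))// normrN.
  rewrite gtr0_norm ?invr_gt0// lerD2l normrM normfV (gtr0_norm e2) ler_wpM2r ?invr_ge0 ?(ltW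
    e2)//.
  rewrite (le_trans (ler_normB _ _))// !normrM (gtr0_norm e0) lerD//.
    by rewrite ler_piMr// sin_max.
  by rewrite ler_piMr ?(ltW e0)// cos_max.
- exact: cvg_cst.
- by rewrite -[X in _ --> X](mul0r M); apply: cvgM => //; exact: cvg_cst.
Qed.

Let cont_abel1cos (e t : R) : continuous (fun p => abel e p * (1 + cos (p * t))).
Proof.
move=> p; apply: cvgM.
  apply: (@continuous_comp _ _ _ (fun p => - (e * `|p|)) expR); last exact: continuous_expR.
  by apply: cvgN; apply: cvgM; [exact: cvg_cst|exact: norm_continuous].
apply: cvgD; first exact: cvg_cst.
apply: continuous_cvg; first exact: continuous_cos.
by apply: cvgM; [exact: cvg_id|exact: cvg_cst].
Qed.

Let integral_abel1cos (e t : R) : 0 < e ->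
  (\int[mu]_p (abel e p * (1 + cos (p * t)))%:E = (2 / e + poisson e t)%:E)%E.
Proof.
move=> e0.
have cos1 x : 0 <= 1 + cos x :> R by rewrite -lerBlDl sub0r cos_geN1.
rewrite ge0_symfun_integralT//; last first.
- by move=> p; rewrite /abel /= normrN mulNr cosN.
- by move=> p; rewrite mulr_ge0 ?expR_ge0.
rewrite -set_itvcy.
rewrite (@ge0_continuous_FTC2y _ _ (F e t) 0 0)//.
- rewrite /F mulr0 oppr0 expR0 mul0r sin0 cos0 -EFinB -EFinM; congr EFin.
  rewrite /poisson; field.
  by rewrite !gt_eqF// ltr_wpDr ?sqr_ge0// exprn_gt0.
- by move=> p _; rewrite mulr_ge0 ?expR_ge0.
- exact: continuous_subspaceT.
- exact: Fy.
- apply: cvg_at_right_filter.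
  by apply/differentiable_continuous/derivable1_diffP; have [] := dF e t 0 e0.
- move=> p; rewrite in_itv/= andbT => p0.
  by rewrite derive1E /abel gtr0_norm//; have [_ ->] := dF e t p e0.
Qed.

Lemma abel_ge0 (e p : R) : 0 <= abel e p. Proof. exact: expR_ge0. Qed.

Lemma abel_le1 (e p : R) : 0 <= e -> abel e p <= 1.
Proof. by move=> e0; rewrite -expR0 ler_expR lerNl oppr0 mulr_ge0. Qed.

Lemma measurable_abel (e : R) : measurable_fun [set: R] (abel e).
Proof.
apply: measurableT_comp => //; apply: measurableT_comp => //.
by apply: measurable_funM => //; exact: measurableT_comp.
Qed.

Lemma integrable_abel (e : R) : 0 < e -> mu.-integrable setT (EFin \o abel e).
Proof.
move=> e0; apply/integrableP; split.
  by apply/measurable_EFinP; exact: measurable_abel.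
apply: le_lt_trans (ltry (2 / e + poisson e 0)).
rewrite -integral_abel1cos//; apply: ge0_le_integral => //.
- by apply: measurableT_comp => //; apply/measurable_EFinP; exact: measurable_abel.
- by apply/measurable_EFinP; apply: continuous_measurable_fun; exact: cont_abel1cos.
- move=> p _/=; rewrite lee_fin mulr0 cos0 ger0_norm ?abel_ge0//.
  by rewrite ler_peMr ?abel_ge0// lerDl.
Qed.

Lemma integral_abel_cos (e t : R) : 0 < e ->
  (\int[mu]_p (abel e p * cos (p * t)) = poisson e t)%R.
Proof.
move=> e0.
have ia := integrable_abel e e0.
have mc : measurable_fun [set: R] (fun p => abel e p * cos (p * t)).
  apply: measurable_funM; first exact: measurable_abel.
  by apply: measurableT_comp; [by apply: continuous_measurable_fun;
    exact: continuous_cos|exact: measurable_funM].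
have iac : mu.-integrable setT (EFin \o (fun p => abel e p * cos (p * t))).
  apply: (le_integrable _ _ _ ia) => //; first exact/measurable_EFinP.
  by move=> p _; rewrite lee_fin normrM ler_piMr ?normr_ge0 ?cos_max.
have h s : \int[mu]_p (abel e p * (1 + cos (p * s))) = 2 / e + poisson e s.
  by rewrite /Rintegral integral_abel1cos.
have ie : \int[mu]_p abel e p = 2 / e.
  have := h 0; under eq_Rintegral do rewrite mulr0 cos0 mulrC.
  rewrite RintegralZl//.
  move=> hh; apply: (@mulfI _ 2) => //.
  rewrite -[2 in LHS]/(1 + 1) hh /poisson expr0n addr0; field.
  by rewrite gt_eqF.
have := h t; under eq_Rintegral do rewrite mulrDr mulr1.
by rewrite (RintegralD measurableT ia iac) ie => /addrI.
Qed.

Lemma poisson_ge0 (e t : R) : 0 <= e -> 0 <= poisson e t.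
Proof. by move=> e0; rewrite divr_ge0 ?mulr_ge0// addr_ge0 ?sqr_ge0. Qed.

Lemma continuous_poisson (e : R) : 0 < e -> continuous (poisson e).
Proof.
move=> e0 t; apply: cvgM; first exact: cvg_cst.
apply: cvgV; first by rewrite gt_eqF// ltr_wpDr ?sqr_ge0// exprn_gt0.
by apply: cvgD; [exact: cvg_cst|exact: exprn_continuous].
Qed.

Lemma measurable_poisson (e : R) : 0 < e -> measurable_fun [set: R] (poisson e).
Proof. by move=> e0; apply: continuous_measurable_fun; exact: continuous_poisson. Qed.

Lemma poissonM (e t : R) : 0 < e -> e * poisson e (e * t) = poisson 1 t.
Proof.
move=> e0; rewrite /poisson; field.
by rewrite gt_eqF ?ltr_wpDr ?sqr_ge0//= gt_eqF// exprMn -{1}(mulr1 (e ^+ 2)) -mulrDr mulr_gt0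
  ?exprn_gt0// ltr_wpDr ?sqr_ge0.
Qed.

Lemma integral_poisson1 : (\int[mu]_t (poisson 1 t)%:E = (2 * pi)%:E)%E.
Proof.
rewrite ge0_symfun_integralT; last first.
- by move=> t; rewrite /poisson/= sqrrN.
- exact: continuous_poisson.
- by move=> t; exact: poisson_ge0.
rewrite -set_itvcy.
under eq_integral => t _.
  rewrite (_ : poisson 1 t = 2 * (oneDsqr t)^-1); last first.
    by rewrite /poisson /oneDsqr mulr1 expr1n.
  rewrite EFinM; over.
rewrite ge0_integralZl//; last first.
  by apply: measurable_funTS; apply/measurable_EFinP; apply: continuous_measurable_fun;
    exact: continuous_oneDsqrV.
by rewrite integral0y_oneDsqr -!EFinM; congr EFin; field.
Qed.

End poisson.

(** * Cosine and sine transforms of integrable functions *)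

Section trig.
Context {R : realType}.
Notation mu := (@lebesgue_measure R).

Lemma measurable_integral2 (F : measurableTypeR R * measurableTypeR R -> \bar R) :
  measurable_fun setT F -> (forall z, 0 <= F z)%E ->
  measurable_fun [set: R] (fun x => \int[mu]_y F (x, y))%E.
Proof. by move=> mF F0; exact: (@measurable_fun_fubini_tonelli_F _ _ _ _ R mu F). Qed.

(** With k = cos and k = sin these are the real and the opposite of the imaginary
    part of the Fourier transform, up to the factor (2 pi)^(-1/2). *)
Definition trig (k u : R -> R) (p : R) : R := \int[mu]_x (u x * k (p * x)).

Section kernel.
Variable k : R -> R.
Hypotheses (mk : measurable_fun [set: R] k) (k1 : forall x, `|k x| <= 1).

Lemma integrable_mul_kernel (u : R -> R) (p : R) :
  mu.-integrable setT (EFin \o u) ->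
  mu.-integrable setT (EFin \o (fun x => u x * k (p * x))).
Proof.
move=> iu; apply: (le_integrable _ _ _ iu) => //.
  apply/measurable_EFinP; apply: measurable_funM.
    by apply/measurable_EFinP; exact: measurable_int iu.
  by apply: measurableT_comp => //; exact: measurable_funM.
by move=> x _; rewrite lee_fin normrM ler_piMr.
Qed.

Let f (phi u : R -> R) (z : R * R) : \bar R := (phi z.1 * (u z.2 * k (z.1 * z.2)))%:E.

Let f_integrable (phi u : R -> R) :
  mu.-integrable setT (EFin \o phi) -> mu.-integrable setT (EFin \o u) ->
  (mu \x mu)%E.-integrable setT (f phi u).
Proof.
move=> iphi iu.
have mphi : measurable_fun [set: R] phi by apply/measurable_EFinP; exact: measurable_int iphi.
have mU : measurable_fun [set: R] u by apply/measurable_EFinP; exact: measurable_int iu.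
have mf : measurable_fun [set: measurableTypeR R * measurableTypeR R] (f phi u).
  apply/measurable_EFinP; apply: measurable_funM.
    exact: (measurableT_comp mphi).
  apply: measurable_funM; first exact: (measurableT_comp mU).
  by apply: (measurableT_comp mk); exact: measurable_funM.
apply: (@integrable12ltyP _ _ _ _ _ mu mu _ mf).2.
apply: (@le_lt_trans _ _ (\int[mu]_p \int[mu]_x (`|(phi p)%:E| * `|(u x)%:E|))%E).
  apply: ge0_le_integral => //.
  - by move=> p _; apply: integral_ge0.
  - apply: (measurable_integral2 (abse \o f phi u)); last by move=> z; exact: abse_ge0.
    by apply: measurableT_comp.
  - apply: (measurable_integral2 (fun z => `|(phi z.1)%:E| * `|(u z.2)%:E|)%E); last by move=> z;
      rewrite mule_ge0.
    apply: emeasurable_funM; apply: measurableT_comp => //; apply/measurable_EFinP.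
      exact: (measurableT_comp mphi).
    exact: (measurableT_comp mU).
  - move=> p _; apply: ge0_le_integral => //.
    + by apply: measurableT_comp => //; exact: (measurableT_comp mf).
    + apply: emeasurable_funM => //; apply: measurableT_comp => //; exact/measurable_EFinP.
    + move=> x _; rewrite -abseM -EFinM /f/= lee_fin !normrM ler_wpM2l//.
      by rewrite ler_piMr.
under eq_integral => p _.
  rewrite ge0_integralZl//; last by apply: measurableT_comp => //; exact/measurable_EFinP.
  over.
rewrite ge0_integralZr//; last 2 first.
- by apply: measurableT_comp => //; exact/measurable_EFinP.
- exact: integral_ge0.
by apply: lte_mul_pinfty; [exact: integral_ge0|
  rewrite ge0_fin_numE ?integral_ge0//|];
  [move/integrableP : iphi => [_]|move/integrableP : iu => [_]].
Qed.

Let fE (phi u : R -> R) : mu.-integrable setT (EFin \o u) ->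
  forall p, (\int[mu]_x f phi u (p, x))%E = (phi p * trig k u p)%:E.
Proof.
move=> iu p; rewrite /f/=.
have ik := integrable_mul_kernel u p iu.
under eq_integral do rewrite EFinM.
rewrite integralZl// EFinM /trig /Rintegral fineK//.
exact: integrable_fin_num.
Qed.

Lemma integrable_mul_trig (phi u : R -> R) :
  mu.-integrable setT (EFin \o phi) -> mu.-integrable setT (EFin \o u) ->
  mu.-integrable setT (EFin \o (fun p => phi p * trig k u p)).
Proof.
move=> iphi iu; have := integrable_fubini_F (f_integrable phi u iphi iu).
by rewrite /fubini_F; under eq_fun do rewrite fE//.
Qed.

(** Fubini for phi (p) u (x) k (p x); the formula is symmetric in phi and u, so
    that it can be applied twice to a square of transforms. *)
Lemma multiplication_formula (phi u : R -> R) :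
  mu.-integrable setT (EFin \o phi) -> mu.-integrable setT (EFin \o u) ->
  \int[mu]_p (phi p * trig k u p) = \int[mu]_x (u x * trig k phi x).
Proof.
move=> iphi iu; have := Fubini (f_integrable phi u iphi iu).
under eq_integral do rewrite fE//.
rewrite /Rintegral => ->; congr fine; apply: eq_integral => x _.
rewrite -fE//; apply: eq_integral => p _.
by rewrite /f/=; congr EFin; rewrite (mulrC x); ring.
Qed.

(** As a function of p alone, [trig k u] need not be integrable, so that Fubini's
    theorem gives its measurability only after multiplication by a positive
    integrable weight, which is then divided out. *)
Lemma measurable_trig (u : R -> R) : mu.-integrable setT (EFin \o u) ->
  measurable_fun [set: R] (trig k u).
Proof.
move=> iu; have ia := @integrable_abel R 1 ltr01.
have m1 : measurable_fun [set: R] (fun p => abel 1 p * trig k u p).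
  by apply/measurable_EFinP; exact: measurable_int (integrable_mul_trig _ _ ia iu).
have m2 : measurable_fun [set: R] (fun p : R => expR (1 * `|p|)).
  by apply: measurableT_comp => //; apply: measurable_funM => //; exact: measurableT_comp.
rewrite (_ : trig k u = fun p => expR (1 * `|p|) * (abel 1 p * trig k u p)).
  exact: measurable_funM.
by apply/funext => p; rewrite mulrA /abel -expRD subrr expR0 mul1r.
Qed.

End kernel.

Lemma measurable_cos : measurable_fun [set: R] cos.
Proof. by apply: continuous_measurable_fun; exact: continuous_cos. Qed.
Lemma measurable_sin : measurable_fun [set: R] sin.
Proof. by apply: continuous_measurable_fun; exact: continuous_sin. Qed.

Definition trig_power (u : R -> R) (p : R) : R := trig cos u p ^+ 2 + trig sin u p ^+ 2.

Lemma trig_power_ge0 u p : 0 <= trig_power u p.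
Proof. by rewrite addr_ge0 ?sqr_ge0. Qed.

Lemma measurable_trig_power u : mu.-integrable setT (EFin \o u) ->
  measurable_fun [set: R] (trig_power u).
Proof.
move=> iu; apply: measurable_funD; apply: measurable_funX; apply: measurable_trig => //.
- exact: measurable_cos.
- exact: cos_max.
- exact: measurable_sin.
- exact: sin_max.
Qed.

Let cosk := (fun u => @integrable_mul_trig cos measurable_cos (@cos_max R) u).
Let sink := (fun u => @integrable_mul_trig sin measurable_sin (@sin_max R) u).

Lemma integrable_abel_power u (e : R) : 0 < e -> mu.-integrable setT (EFin \o u) ->
  mu.-integrable setT (EFin \o (fun p => abel e p * trig_power u p)).
Proof.
move=> e0 iu; have ia := integrable_abel e e0.
have := integrableD measurableT (cosk _ _ (cosk _ _ ia iu) iu) (sink _ _ (sink _ _ ia iu) iu).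
apply: eq_integrable => // p _ /=.
by rewrite -EFinD; congr EFin; rewrite /trig_power; ring.
Qed.

(** Second application of the multiplication formula, to the factor
    [abel e p * k (x * p)] with x fixed. *)
Lemma trig_abel_kernel u (k : R -> R) (e x : R) : 0 < e ->
  measurable_fun [set: R] k -> (forall x, `|k x| <= 1) ->
  mu.-integrable setT (EFin \o u) ->
  let phi := fun p => abel e p * k (x * p) in
  [/\ mu.-integrable setT (EFin \o phi),
      mu.-integrable setT (EFin \o (fun y => u y * trig k phi y)) &
      trig k (fun p => abel e p * trig k u p) x = \int[mu]_y (u y * trig k phi y)].
Proof.
move=> e0 mk k1 iu phi; have ia := integrable_abel e e0.
have iphi : mu.-integrable setT (EFin \o phi) by exact: integrable_mul_kernel.
split => //.
- exact: integrable_mul_trig.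
- rewrite -(multiplication_formula k mk k1 phi u iphi iu) /trig.
  by apply: eq_Rintegral => p _; rewrite /phi -!mulrA; congr *%R; rewrite mulrC.
Qed.

(** The two products of transforms combine by the formula for cos (p x - p y). *)
Lemma poisson_average u (e x : R) : 0 < e -> mu.-integrable setT (EFin \o u) ->
  \int[mu]_y (u y * poisson e (x - y)) =
  trig cos (fun p => abel e p * trig cos u p) x +
  trig sin (fun p => abel e p * trig sin u p) x.
Proof.
move=> e0 iu.
have [ic icu ->] := trig_abel_kernel u cos e x e0 measurable_cos (@cos_max R) iu.
have [iss isu ->] := trig_abel_kernel u sin e x e0 measurable_sin (@sin_max R) iu.
rewrite -RintegralD//.
apply: eq_Rintegral => y _; rewrite -mulrDr; congr *%R.
rewrite -integral_abel_cos// /trig -RintegralD//.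
- apply: eq_Rintegral => p _; rewrite mulrBr cosB (mulrC p x) (mulrC p y); ring.
- exact: (integrable_mul_kernel cos measurable_cos (@cos_max R) _ y ic).
- exact: (integrable_mul_kernel sin measurable_sin (@sin_max R) _ y iss).
Qed.

(** The Abel means of the energy of the transforms are a quadratic form with a
    positive kernel, to which both inequalities between the energies of u and of
    its transforms reduce. *)
Lemma integral_abel_power u (e : R) : 0 < e -> mu.-integrable setT (EFin \o u) ->
  mu.-integrable setT (EFin \o (fun x => u x * \int[mu]_y (u y * poisson e (x - y)))) /\
  \int[mu]_p (abel e p * trig_power u p) =
  \int[mu]_x (u x * \int[mu]_y (u y * poisson e (x - y))).
Proof.
move=> e0 iu; have ia := integrable_abel e e0.
pose pc p := abel e p * trig cos u p; pose ps p := abel e p * trig sin u p.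
have ipc : mu.-integrable setT (EFin \o pc) by exact: cosk.
have ips : mu.-integrable setT (EFin \o ps) by exact: sink.
split.
  have := integrableD measurableT (cosk _ _ iu ipc) (sink _ _ iu ips).
  apply: eq_integrable => // x _ /=.
  by rewrite -EFinD -mulrDr (poisson_average _ _ _ e0 iu).
transitivity (\int[mu]_p (pc p * trig cos u p + ps p * trig sin u p)).
  by apply: eq_Rintegral => p _; rewrite /pc /ps /trig_power; ring.
rewrite RintegralD//; [|exact: cosk|exact: sink].
rewrite (multiplication_formula cos measurable_cos (@cos_max R) pc u)// (multiplication_formula
  sin measurable_sin (@sin_max R) ps u)//.
rewrite -RintegralD//; [|exact: cosk|exact: sink].
by apply: eq_Rintegral => x _; rewrite -mulrDr (poisson_average _ _ _ e0 iu).
Qed.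
End trig.

(** * Bessel's inequality *)

Section bessel.
Context {R : realType}.
Notation mu := (@lebesgue_measure R).

Definition sqint (u : R -> R) : \bar R := (\int[mu]_x ((u x) ^+ 2)%:E)%E.

Let mP (e : R) : 0 < e -> measurable_fun [set: R] (poisson e).
Proof. exact: measurable_poisson. Qed.

Lemma poissonN (e t : R) : poisson e (- t) = poisson e t.
Proof. by rewrite /poisson sqrrN. Qed.

Lemma measurable_poissonB (e x : R) : 0 < e ->
  measurable_fun [set: R] (fun y => poisson e (x - y)).
Proof. by move=> e0; apply: (measurableT_comp (mP e e0)); exact: measurable_funB. Qed.

Lemma integral_poissonB (e x : R) : 0 < e ->
  (\int[mu]_y (poisson e (x - y))%:E = (2 * pi)%:E)%E.
Proof.
move=> e0.
rewrite (ge0_integral_affine (- e) x); last 3 first.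
- by rewrite oppr_eq0 gt_eqF.
- by apply/measurable_EFinP; exact: measurable_poissonB.
- by move=> y; rewrite lee_fin poisson_ge0// ltW.
rewrite -ge0_integralZl//; last 2 first.
- by apply/measurable_EFinP; apply: (measurableT_comp (mP e e0)); apply: measurable_funB => //;
    apply: measurable_funD => //; exact: measurable_funM.
- by move=> t _; rewrite lee_fin poisson_ge0// ltW.
rewrite -integral_poisson1; apply: eq_integral => t _.
rewrite -EFinM normrN gtr0_norm// -(poissonM e t e0); congr (_ * poisson _ _)%:E; ring.
Qed.

Lemma poisson_le (e t : R) : 0 < e -> poisson e t <= 2 / e.
Proof.
move=> e0; rewrite /poisson ler_pdivrMr; last by rewrite ltr_wpDr ?sqr_ge0// exprn_gt0.
rewrite mulrDr -[leLHS]addr0 lerD//; last by rewrite mulr_ge0 ?sqr_ge0 ?divr_ge0 ?ltW.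
by rewrite expr2 mulrA divfK// gt_eqF.
Qed.

Lemma integrable_mul_poissonB (u : R -> R) (e x : R) : 0 < e ->
  mu.-integrable setT (EFin \o u) ->
  mu.-integrable setT (EFin \o (fun y => u y * poisson e (x - y))).
Proof.
move=> e0 iu.
have := integrableZl measurableT (2 / e) iu.
apply: le_integrable => //.
  apply/measurable_EFinP; apply: measurable_funM; last exact: measurable_poissonB.
  by apply/measurable_EFinP; exact: measurable_int iu.
move=> y _; rewrite /= lee_fin (normrM (u y)) (normrM (2 / e)) mulrC ler_wpM2r//.
by rewrite ger0_norm ?poisson_ge0 ?(ltW e0)// (le_trans (poisson_le e _ e0))// ler_norm.
Qed.

Lemma abse_fine_le (z : \bar R) : (`|(fine z)%:E| <= `|z|)%E.
Proof. by case: z => [r| |] //=; rewrite ?normr0 ?leey. Qed.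

(** Schur's test: |u (x) u (y)| <= (u (x)^2 + u (y)^2) / 2 and the kernel has mass
    2 pi in each variable. *)
Lemma bessel_abel (u : R -> R) (e : R) : 0 < e -> mu.-integrable setT (EFin \o u) ->
  (\int[mu]_p (abel e p * trig_power u p)%:E <= (2 * pi)%:E * sqint u)%E.
Proof.
move=> e0 iu; have [iuA Q] := integral_abel_power u e e0 iu.
have e0' := ltW e0.
have mU : measurable_fun [set: R] u by apply/measurable_EFinP; exact: measurable_int iu.
rewrite -[leLHS]fineK; last by apply: integrable_fin_num => //; exact: integrable_abel_power.
rewrite -/(Rintegral _ _ _) Q (le_trans (lee_abs _))// (le_trans (abse_fine_le _))//.
rewrite (le_trans (le_abse_integral _ _ (measurable_int _ iuA)))//.
pose F (z : measurableTypeR R * measurableTypeR R) : \bar R :=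
  (u z.1 ^+ 2 / 2 * poisson e (z.1 - z.2))%:E.
pose G (z : measurableTypeR R * measurableTypeR R) : \bar R :=
  (u z.2 ^+ 2 / 2 * poisson e (z.1 - z.2))%:E.
have mPB : measurable_fun [set: measurableTypeR R * measurableTypeR R] (fun z => poisson e (z.1 -
  z.2)).
  by apply: (measurableT_comp (mP e e0)); exact: measurable_funB.
have mF : measurable_fun setT F.
  apply/measurable_EFinP; apply: measurable_funM => //; apply: measurable_funM => //.
  by apply: measurable_funX; exact: (measurableT_comp mU).
have mG : measurable_fun setT G.
  apply/measurable_EFinP; apply: measurable_funM => //; apply: measurable_funM => //.
  by apply: measurable_funX; exact: (measurableT_comp mU).
have F0 z : (0 <= F z)%E by rewrite lee_fin mulr_ge0 ?poisson_ge0// mulr_ge0// sqr_ge0.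
have G0 z : (0 <= G z)%E by rewrite lee_fin mulr_ge0 ?poisson_ge0// mulr_ge0// sqr_ge0.
apply: (@le_trans _ _ (\int[mu]_x (\int[mu]_y F (x, y) + \int[mu]_y G (x, y)))%E).
  apply: ge0_le_integral => //.
  - by apply: measurableT_comp => //; exact: measurable_int iuA.
  - by apply: emeasurable_funD; exact: measurable_integral2.
  - move=> x _ /=.
    rewrite -ge0_integralD//; last 2 first.
      exact: (measurableT_comp mF).
      exact: (measurableT_comp mG).
    rewrite normrM EFinM.
    have ip := integrable_mul_poissonB u e x e0 iu.
    apply: (@le_trans _ _ (`|u x|%:E * \int[mu]_y `|(u y * poisson e (x - y))%:E|)%E).
      rewrite lee_wpmul2l//; apply: (le_trans (abse_fine_le _)).
      by apply: le_abse_integral => //; exact: measurable_int ip.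
    rewrite -ge0_integralZl//; last by apply: measurableT_comp => //; exact: measurable_int ip.
    apply: ge0_le_integral => //.
    + by apply: emeasurable_funM => //; apply: measurableT_comp => //; exact: measurable_int ip.
    + by apply: emeasurable_funD; [exact: (measurableT_comp mF)|exact: (measurableT_comp mG)].
    + move=> y _; rewrite -EFinM -EFinD lee_fin/= normrM [`|poisson _ _|]ger0_norm ?poisson_ge0//.
      rewrite -mulrDl mulrA ler_wpM2r ?poisson_ge0//.
      rewrite -(real_normK (num_real (u x))) -(real_normK (num_real (u y))).
      have := sqr_ge0 (`|u x| - `|u y|); lra.
rewrite ge0_integralD//; last 4 first.
- by move=> x _; apply: integral_ge0.
- exact: measurable_integral2.
- by move=> x _; apply: integral_ge0.
- exact: measurable_integral2.
have half : (\int[mu]_x ((u x) ^+ 2 / 2 * (2 * pi))%:E = pi%:E * sqint u)%E.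
  rewrite /sqint -ge0_integralZl//; last 3 first.
  - by apply/measurable_EFinP; exact: measurable_funX.
  - by move=> x _; rewrite lee_fin sqr_ge0.
  - by rewrite lee_fin pi_ge0.
  by apply: eq_integral => x _; rewrite -EFinM; congr EFin; field.
have -> : (\int[mu]_x \int[mu]_y F (x, y) = pi%:E * sqint u)%E.
  rewrite -half; apply: eq_integral => x _; rewrite /F/=.
  under eq_integral do rewrite EFinM.
  rewrite ge0_integralZl//; last 3 first.
  - by apply/measurable_EFinP; exact: measurable_poissonB.
  - by move=> y _; rewrite lee_fin poisson_ge0.
  - by rewrite lee_fin mulr_ge0// sqr_ge0.
  by rewrite integral_poissonB// -EFinM.
have -> : (\int[mu]_x \int[mu]_y G (x, y) = pi%:E * sqint u)%E.
  rewrite fubini_tonelli//.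
  rewrite -half; apply: eq_integral => y _; rewrite /G/=.
  under eq_integral do rewrite EFinM -poissonN opprB.
  rewrite ge0_integralZl//; last 3 first.
  - by apply/measurable_EFinP; exact: measurable_poissonB.
  - by move=> x _; rewrite lee_fin poisson_ge0.
  - by rewrite lee_fin mulr_ge0// sqr_ge0.
  by rewrite integral_poissonB// -EFinM.
rewrite -ge0_muleDl ?lee_fin ?pi_ge0// -EFinD lee_wpmul2r//.
  by apply: integral_ge0 => x _; rewrite lee_fin sqr_ge0.
by rewrite lee_fin; lra.
Qed.

Lemma cvg_abel (p : R) : abel n.+1%:R^-1 p @[n --> \oo] --> (1 : R).
Proof.
have h : n.+1%:R^-1 * `|p| @[n --> \oo] --> 0 * `|p|.
  by apply: cvgMr_tmp; exact: (@cvg_harmonic R).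
suff : abel n.+1%:R^-1 p @[n --> \oo] --> expR (- (0 * `|p|)).
  by rewrite mul0r oppr0 expR0.
apply: (cvg_comp _ (fun x : R => expR (- x)) h).
by apply: (@continuous_comp _ _ _ -%R expR); [exact: opp_continuous|exact: continuous_expR].
Qed.

(** Monotone convergence along the weights [abel (1 / (n + 1))]. *)
Lemma bessel (u : R -> R) : mu.-integrable setT (EFin \o u) ->
  (\int[mu]_p (trig_power u p)%:E <= (2 * pi)%:E * sqint u)%E.
Proof.
move=> iu.
pose q n p := (abel n.+1%:R^-1 p * trig_power u p)%:E : \bar R.
have mq n : measurable_fun [set: R] (q n).
  apply/measurable_EFinP; apply: measurable_funM;
    [exact: measurable_abel|exact: measurable_trig_power].
have q0 n p : (0 <= q n p)%E by rewrite lee_fin mulr_ge0 ?abel_ge0 ?trig_power_ge0.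
have nd p : {homo q ^~ p : n m / (n <= m)%N >-> (n <= m)%E}.
  move=> n m nm; rewrite lee_fin ler_wpM2r ?trig_power_ge0// ler_expR lerN2 ler_wpM2r//.
  by rewrite lef_pV2 ?posrE ?ltr0n// ler_nat.
have h := @cvg_monotone_convergence _ _ _ mu _ measurableT q mq (fun n p _ => q0 n p) (fun p _ =>
  nd p).
rewrite (_ : (\int[mu]_p (trig_power u p)%:E = \int[mu]_p limn (q ^~ p))%E); last first.
  apply: eq_integral => p _; apply/esym/cvg_lim => //.
  apply: cvg_EFin; first exact: nearW.
  by rewrite -[X in _ --> X]mul1r; apply: cvgM; [exact: cvg_abel|exact: cvg_cst].
rewrite -(cvg_lim _ h)//; apply: lime_le; first by apply/cvg_ex; eexists; exact: h.
by apply: nearW => n; apply: bessel_abel => //; rewrite invr_gt0.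
Qed.

End bessel.

(** * The reverse inequality for functions continuous where they do not vanish *)

Section lower.
Context {R : realType}.
Notation mu := (@lebesgue_measure R).

Lemma integrable_poisson1 : mu.-integrable setT (EFin \o @poisson R 1).
Proof.
apply/integrableP; split; first by apply/measurable_EFinP; exact: measurable_poisson.
under eq_integral => t _ do rewrite /= ger0_norm ?poisson_ge0//.
by rewrite integral_poisson1 ltry.
Qed.

Lemma integrable_bounded_poisson1 (v : R -> R) (m : R) :
  measurable_fun [set: R] v -> (forall x, `|v x| <= m) ->
  mu.-integrable setT (EFin \o (fun t => v t * poisson 1 t)).
Proof.
move=> mv vm; have := integrableZl measurableT m integrable_poisson1.
apply: le_integrable => //.
  apply/measurable_EFinP; apply: measurable_funM => //; exact: measurable_poisson.
move=> t _; rewrite /= lee_fin !normrM ler_wpM2r//.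
exact: le_trans (vm t) (ler_norm m).
Qed.

(** The substitution y = x - e t moves the dependence on e from the kernel to the
    function, so that dominated convergence applies as e tends to 0. *)
Lemma poisson_average_rescale (g : R -> R) (m e x : R) : 0 < e ->
  measurable_fun [set: R] g -> (forall x, `|g x| <= m) ->
  \int[mu]_y (g y * poisson e (x - y)) = \int[mu]_t (g (- e * t + x) * poisson 1 t).
Proof.
move=> e0 mg gm.
have mge : measurable_fun [set: R] (fun t => g (- e * t + x)).
  by apply: (measurableT_comp mg); apply: measurable_funD => //; exact: measurable_funM.
have ig := integrable_bounded_poisson1 (fun t => g (- e * t + x)) m mge (fun=> gm _).
have E t : g (- e * t + x) * poisson e (x - (- e * t + x)) = e^-1 * (g (- e * t + x) * poisson 1
  t).
  rewrite -(poissonM e t e0); have -> : x - (- e * t + x) = e * t by ring.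
  by field; rewrite gt_eqF.
rewrite /Rintegral; congr fine.
rewrite (integral_affine (- e) x); last 3 first.
- by rewrite oppr_eq0 gt_eqF.
- by apply/measurable_EFinP; apply: measurable_funM => //; exact: measurable_poissonB.
- under eq_fun do rewrite /= E EFinM.
  exact: integrableZl.
transitivity (e%:E * \int[mu]_t ((e^-1)%:E * (g (- e * t + x) * poisson 1 t)%:E))%E.
  rewrite normrN gtr0_norm//; congr (_ * _)%E.
  by apply: eq_integral => t _; rewrite E EFinM.
by rewrite integralZl// muleA -EFinM divff ?mul1e// gt_eqF.
Qed.

Lemma poisson_average_le (g : R -> R) (m e x : R) : 0 < e ->
  measurable_fun [set: R] g -> (forall x, `|g x| <= m) ->
  `|\int[mu]_y (g y * poisson e (x - y))| <= m * (2 * pi).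
Proof.
move=> e0 mg gm; rewrite (poisson_average_rescale g m)//.
have mge : measurable_fun [set: R] (fun t => g (- e * t + x)).
  by apply: (measurableT_comp mg); apply: measurable_funD => //; exact: measurable_funM.
have ig := integrable_bounded_poisson1 (fun t => g (- e * t + x)) m mge (fun=> gm _).
apply: le_trans (le_normr_Rintegral _ ig) _ => //.
have -> : m * (2 * pi) = \int[mu]_t (m * poisson 1 t).
  rewrite RintegralZl//; last exact: integrable_poisson1.
  by rewrite /Rintegral integral_poisson1.
apply: le_Rintegral => //.
- exact: (integrable_abse ig).
- exact: (integrableZl measurableT m integrable_poisson1).
- by move=> t _; rewrite normrM (ger0_norm (poisson_ge0 1 t ler01)) ler_wpM2r ?poisson_ge0.
Qed.

Lemma cvg_Rintegral_dominated (f_ : nat -> R -> R) (f g : R -> R) :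
  (forall n, measurable_fun [set: R] (f_ n)) -> measurable_fun [set: R] f ->
  (forall x, f_ n x @[n --> \oo] --> f x) ->
  mu.-integrable setT (EFin \o g) -> (forall n x, `|f_ n x| <= g x) ->
  (\int[mu]_x f_ n x) @[n --> \oo] --> \int[mu]_x f x.
Proof.
move=> mf_ mf ff ig fg.
have [|||||i _ c] := @dominated_convergence _ _ _ mu setT measurableT
  (fun n => EFin \o f_ n) (EFin \o f) (EFin \o g).
- by move=> n; apply/measurable_EFinP; exact: mf_.
- exact/measurable_EFinP.
- by apply/nearW => x _; apply: cvg_EFin; [exact: nearW|exact: ff].
- exact: ig.
- by apply/nearW => x n _; rewrite /= lee_fin; exact: fg.
rewrite /Rintegral; apply: fine_cvg.
by rewrite fineK//; apply: integrable_fin_num.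
Qed.

Lemma cvg_poisson_average (g : R -> R) (m x : R) :
  measurable_fun [set: R] g -> (forall x, `|g x| <= m) -> {for x, continuous g} ->
  (\int[mu]_y (g y * poisson n.+1%:R^-1 (x - y))) @[n --> \oo] --> g x * (2 * pi).
Proof.
move=> mg gm gx.
have -> : g x * (2 * pi) = \int[mu]_t (g x * poisson 1 t).
  rewrite RintegralZl//; last exact: integrable_poisson1.
  by rewrite /Rintegral integral_poisson1.
under eq_cvg do rewrite (poisson_average_rescale g m) ?invr_gt0//.
apply: (cvg_Rintegral_dominated _ _ (fun t => m * poisson 1 t)).
- move=> n; apply: measurable_funM; last exact: measurable_poisson.
  by apply: (measurableT_comp mg); apply: measurable_funD => //; exact: measurable_funM.
- by apply: measurable_funM => //; exact: measurable_poisson.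
- move=> t; apply: cvgMr_tmp.
  have h : - n.+1%:R^-1 * t + x @[n --> \oo] --> - 0 * t + x.
    apply: cvgD; last exact: cvg_cst.
    by apply: cvgMr_tmp; apply: cvgN; exact: (@cvg_harmonic R).
  rewrite oppr0 mul0r add0r in h.
  exact: (cvg_comp _ g h gx).
- exact: (integrableZl measurableT m integrable_poisson1).
- move=> n t.
  by rewrite normrM (ger0_norm (poisson_ge0 1 t ler01)) ler_wpM2r ?poisson_ge0.
Qed.

(** The Poisson averages of g converge to 2 pi g wherever g is continuous; the
    other points carry the factor g (x) = 0.  This allows jumps at the boundary of
    the support, so that functions cut off by an indicator are admissible. *)
Lemma plancherel_ge (g : R -> R) (m : R) : mu.-integrable setT (EFin \o g) ->
  (forall x, `|g x| <= m) -> (forall x, g x != 0 -> {for x, continuous g}) ->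
  ((2 * pi)%:E * sqint g <= \int[mu]_p (trig_power g p)%:E)%E.
Proof.
move=> ig gm gc.
have mg : measurable_fun [set: R] g by apply/measurable_EFinP; exact: measurable_int ig.
have ig2 : mu.-integrable setT (EFin \o (fun x => g x ^+ 2)).
  have := integrableZl measurableT m ig.
  apply: le_integrable => //; first by apply/measurable_EFinP; exact: measurable_funX.
  move=> x _; rewrite /= lee_fin normrX normrM expr2 ler_wpM2r//.
  exact: le_trans (gm x) (ler_norm m).
have e0 n : 0 < n.+1%:R^-1 :> R by rewrite invr_gt0.
pose A n x := \int[mu]_y (g y * poisson n.+1%:R^-1 (x - y)).
have iA n : mu.-integrable setT (EFin \o (fun x => g x * A n x)).
  by have [] := integral_abel_power g n.+1%:R^-1 (e0 n) ig.
have QA n : \int[mu]_p (abel n.+1%:R^-1 p * trig_power g p) = \int[mu]_x (g x * A n x).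
  by have [] := integral_abel_power g n.+1%:R^-1 (e0 n) ig.
have h : (\int[mu]_x (g x * A n x)) @[n --> \oo] --> \int[mu]_x ((2 * pi) * g x ^+ 2).
  apply: (cvg_Rintegral_dominated _ _ (fun x => m * (2 * pi) * `|g x|)).
  - by move=> n; apply/measurable_EFinP; exact: measurable_int (iA n).
  - by apply: measurable_funM => //; exact: measurable_funX.
  - move=> x; have [->|gx] := eqVneq (g x) 0.
      by rewrite expr0n mulr0; under eq_cvg do rewrite mul0r; exact: cvg_cst.
    have -> : 2 * pi * g x ^+ 2 = g x * (g x * (2 * pi)) by ring.
    by apply: cvgMl_tmp; apply: (cvg_poisson_average g m) => //; exact: gc.
  - have := integrableZl measurableT (m * (2 * pi)) (integrable_abse ig).
    by apply: eq_integrable.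
  - move=> n x; rewrite normrM mulrC ler_wpM2r//.
    by apply: poisson_average_le => //; rewrite invr_gt0.
have -> : ((2 * pi)%:E * sqint g = (\int[mu]_x ((2 * pi) * g x ^+ 2))%:E)%E.
  rewrite RintegralZl// [RHS]EFinM /sqint /Rintegral fineK//.
  exact: integrable_fin_num.
have {}h : (\int[mu]_x (g x * A n x))%:E @[n --> \oo] --> (\int[mu]_x (2 * pi * g x ^+ 2))%:E.
  by apply: cvg_EFin; [exact: nearW|exact: h].
rewrite -(cvg_lim _ h)//; apply: lime_le; first by apply/cvg_ex; eexists; exact: h.
apply: nearW => n /=; rewrite -QA.
rewrite /Rintegral fineK; last by apply: integrable_fin_num => //; exact: integrable_abel_power.
apply: ge0_le_integral => //.
- by move=> p _; rewrite lee_fin mulr_ge0 ?abel_ge0 ?trig_power_ge0.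
- exact: measurable_int (integrable_abel_power g _ (e0 n) ig).
- by apply/measurable_EFinP; exact: measurable_trig_power.
- by move=> p _; rewrite lee_fin ler_piMl ?trig_power_ge0 ?abel_le1// ltW.
Qed.
End lower.

(** * Truncation in height *)

Section density.
Context {R : realType}.
Notation mu := (@lebesgue_measure R).

Definition clip (m x : R) : R := Num.max (- m) (Num.min m x).

Lemma clip_le (m x : R) : 0 <= m -> `|clip m x| <= m.
Proof.
move=> m0; rewrite /clip ler_norml le_max lexx/= ge_max ge_min lexx andbT.
by rewrite (le_trans _ m0)// oppr_le0.
Qed.

Lemma clip_id (m x : R) : `|x| <= m -> clip m x = x.
Proof. by rewrite ler_norml => /andP[mx xm]; rewrite /clip min_r// max_r. Qed.

Lemma clip_lipschitz (m x y : R) : 0 <= m -> `|clip m x - clip m y| <= `|x - y|.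
Proof.
move=> m0; rewrite /clip !minEle.
have := ler_norm (x - y); have := ler_norm (- (x - y)); rewrite normrN => ? ?.
by case: (lerP m x) => ?; case: (lerP m y) => ?; rewrite !maxEle;
  repeat match goal with |- context [if ?a <= ?b then _ else _] => case: (lerP a b) => ? end;
    rewrite ler_norml; lra.
Qed.

Lemma clip0 (m : R) : 0 <= m -> clip m 0 = 0.
Proof. by move=> m0; rewrite clip_id// normr0. Qed.

Lemma continuous_clip (m : R) : continuous (clip m).
Proof.
move=> x; apply: (@continuous_max _ _ (cst (- m)) (fun x => Num.min m x)); first exact: cvg_cst.
by apply: (@continuous_min _ _ (cst m) id); [exact: cvg_cst|exact: cvg_id].
Qed.

Lemma measurable_clip (m : R) (u : R -> R) : measurable_fun [set: R] u ->
  measurable_fun [set: R] (clip m \o u).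
Proof.
by apply: measurableT_comp; apply: continuous_measurable_fun; exact: continuous_clip.
Qed.

Lemma measurable_sqr (u : R -> R) : measurable_fun [set: R] u ->
  measurable_fun [set: R] (fun x => ((u x) ^+ 2)%:E).
Proof. by move=> mU; apply/measurable_EFinP; exact: measurable_funX. Qed.

Lemma sqint_ge0 (u : R -> R) : (0 <= sqint u)%E.
Proof. by apply: integral_ge0 => x _; rewrite lee_fin sqr_ge0. Qed.

Lemma integrable_sqr (u : R -> R) : measurable_fun [set: R] u -> (sqint u < +oo)%E ->
  mu.-integrable setT (EFin \o (fun x => u x ^+ 2)).
Proof.
move=> mU uoo; apply/integrableP; split; first exact: measurable_sqr.
by under eq_integral => x _ do rewrite /= ger0_norm ?sqr_ge0//.
Qed.

(** From (a + b)^2 <= 2 a^2 + 2 b^2. *)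
Lemma sqint_leD (u v w : R -> R) :
  measurable_fun [set: R] u -> measurable_fun [set: R] v -> measurable_fun [set: R] w ->
  (forall x, w x = u x + v x) -> (sqint w <= 2%:E * sqint u + 2%:E * sqint v)%E.
Proof.
move=> mU mV mW wE.
rewrite /sqint -!ge0_integralZl//; try exact: measurable_sqr; try by move=> x _;
  rewrite lee_fin sqr_ge0.
rewrite -ge0_integralD//; try (by move=> x _; rewrite mule_ge0 ?lee_fin ?sqr_ge0);
  try by apply: measurable_funeM; exact: measurable_sqr.
apply: ge0_le_integral => //.
- by move=> x _; rewrite lee_fin sqr_ge0.
- exact: measurable_sqr.
- by apply: emeasurable_funD; apply: measurable_funeM; exact: measurable_sqr.
- move=> x _; rewrite -!EFinM -EFinD lee_fin wE.
  by have := sqr_ge0 (u x - v x); lra.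
Qed.

Lemma clip_approx (u : R -> R) (d : R) : 0 < d -> measurable_fun [set: R] u ->
  (sqint u < +oo)%E ->
  exists2 m : R, 0 < m & (sqint (fun x => u x - clip m (u x))%R <= d%:E)%E.
Proof.
move=> d0 mU uoo; have iu2 := integrable_sqr u mU uoo.
have mC m : measurable_fun [set: R] (fun x => u x - clip m (u x)).
  by apply: measurable_funB => //; exact: measurable_clip.
have le2 (n : nat) x : (u x - clip n%:R (u x)) ^+ 2 <= u x ^+ 2.
  rewrite -[leLHS]real_normK ?num_real// -[leRHS]real_normK ?num_real//.
  rewrite lerXn2r ?nnegrE//.
  rewrite /clip minEle; have := ler_norm (u x); have := ler_norm (- u x); rewrite normrN => ? ?.
  have := ler0n R n; case: (lerP n%:R (u x)) => ?; rewrite maxEle;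
    repeat match goal with |- context [if ?a <= ?b then _ else _] => case: (lerP a b) => ? end;
      move=> ?; rewrite ler_norml; lra.
have : \int[mu]_x (u x - clip n%:R (u x)) ^+ 2 @[n --> \oo] --> \int[mu]_x (cst 0 x).
  apply: (cvg_Rintegral_dominated _ _ (fun x => u x ^+ 2)) => //.
  - by move=> n; exact: measurable_funX.
  - move=> x; apply: cvg_near_cst; near=> n.
    rewrite clip_id ?subrr ?expr0n//; near: n.
    exact: nbhs_infty_ger.
  - by move=> n x; rewrite ger0_norm ?sqr_ge0.
rewrite /Rintegral integral0 => /cvgrPdist_le /(_ _ d0)[n _ /(_ n.+1 (leqnSn n))].
rewrite /= sub0r normrN => h; exists n.+1%:R => //.
have fin : sqint (fun x => u x - clip n.+1%:R (u x)) \is a fin_num.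
  rewrite ge0_fin_numE ?sqint_ge0//; apply: le_lt_trans uoo.
  apply: ge0_le_integral => //; try exact: measurable_sqr.
  - by move=> x _; rewrite lee_fin sqr_ge0.
  - by move=> x _; rewrite lee_fin.
by rewrite -(fineK fin) lee_fin (le_trans (ler_norm _)).
Unshelve. all: by end_near. Qed.

End density.

(** * Density in L2 of functions continuous where they do not vanish *)

Section compact_plancherel.
Context {R : realType}.
Notation mu := (@lebesgue_measure R).

Lemma lebesgue_measure_itvoo_lty (a b : R) : (mu (`]a, b[%classic : set R) < +oo)%E.
Proof. by rewrite lebesgue_measure_itv/=; case: ifP => _; rewrite ?ltry// -EFinB ltry. Qed.

Lemma integrable_bounded_support (N : R) (v : R -> R) (m : R) :
  measurable_fun [set: R] v -> (forall x, `|v x| <= m) ->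
  (forall x, x \notin `]-N, N[ -> v x = 0) -> mu.-integrable setT (EFin \o v).
Proof.
move=> mv vm v0.
have mE : measurable (`]-N, N[%classic : set R) by [].
have : mu.-integrable (`]-N, N[%classic : set R) (EFin \o v).
  apply: measurable_bounded_integrable => //.
  - exact: lebesgue_measure_itvoo_lty.
  - exact: measurable_funTS.
  - exists m; split; first exact: num_real.
    by move=> y my x _ /=; exact: le_trans (vm x) (ltW my).
move/(@integrable_mkcond _ _ _ mu _ (EFin \o v) mE); apply: eq_integrable => // x _.
rewrite patchE; case: ifPn => // xE /=; rewrite v0//.
by apply: contra xE; rewrite inE.
Qed.

(** First cut u off in height, at the cost of d / 4; the resulting bounded function
    is approximated in L1 on the interval by continuous functions, which may be cut
    off at the same height m, and for functions bounded by m the L1 distance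
    controls the square of the L2 distance up to the factor 2 m. *)
Lemma L2_dense (u : R -> R) (N d : R) : 0 < d ->
  measurable_fun [set: R] u -> (sqint u < +oo)%E ->
  (forall x, x \notin `]-N, N[ -> u x = 0) ->
  exists g m, [/\ mu.-integrable setT (EFin \o g), forall x, `|g x| <= m,
    forall x, g x != 0 -> {for x, continuous g} &
    (sqint (fun x => u x - g x)%R <= d%:E)%E].
Proof.
move=> d0 mU uoo u0.
have d40 : 0 < d / 4 by rewrite divr_gt0.
have [m m0 hm] := clip_approx u (d / 4) d40 mU uoo.
pose E := (`]-N, N[%classic : set R).
have mE : measurable E by exact: measurable_itv.
have Efin : (mu E < +oo)%E.
  exact: lebesgue_measure_itvoo_lty.
pose v := clip m \o u.
have mv : measurable_fun [set: R] v by exact: measurable_clip.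
have v0 x : x \notin `]-N, N[ -> v x = 0 by move=> /u0; rewrite /v/= => ->; rewrite clip0// ltW.
have iv : mu.-integrable setT (EFin \o v).
  by apply: (integrable_bounded_support N v m) => // x; exact: clip_le (ltW m0).
have ivE : mu.-integrable E (EFin \o v) by apply: (integrableS _ _ _ iv).
have [h [hc hi]] := approximation_continuous_integrable mE Efin ivE.
(* The L1 error that the factor 2 m turns into an error d / 4. *)
pose d' := d / 4 / (2 * m).
have d'0 : 0 < d' by rewrite !divr_gt0// mulr_gt0.
move=> /fine_cvgP[hf] /cvgrPdist_le /(_ _ d'0).
move=> [k1 _ hk1]; have [k2 _ hk2] := hf.
pose k := maxn k1 k2.
have {}hk1 := hk1 k (leq_maxl _ _); have {}hk2 := hk2 k (leq_maxr _ _).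
have hk : (\int[mu]_(z in E) `|(v z - h k z)%:E| <= d'%:E)%E.
  by rewrite -(fineK hk2) lee_fin; move: hk1; rewrite /= sub0r normrN; apply: le_trans;
    exact: ler_norm.
have mh : measurable_fun [set: R] (h k) by exact: continuous_measurable_fun.
pose g x := clip m (h k x) * \1_E x.
have mg : measurable_fun [set: R] g.
  by apply: measurable_funM; [exact: measurable_clip|exact: measurable_indic].
have gE x : x \in `]-N, N[ -> g x = clip m (h k x).
  by move=> xE; rewrite /g indicE mem_set ?mulr1.
have g0 x : x \notin `]-N, N[ -> g x = 0.
  by move=> xE; rewrite /g indicE memNset ?mulr0//; exact/negP.
have gm x : `|g x| <= m.
  have [xE|xE] := boolP (x \in `]-N, N[); first by rewrite gE// clip_le// ltW.
  by rewrite g0// normr0 ltW.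
exists g, m; split => //.
- exact: integrable_bounded_support g0.
- move=> x gx; have xE : x \in `]-N, N[ by apply: contraNT gx => /g0 ->; rewrite eqxx.
  have : {for x, continuous (clip m \o h k)}.
    by apply: continuous_comp; [exact: hc|exact: continuous_clip].
  rewrite /prop_for /continuous_at gE//; apply: cvg_trans; apply: near_eq_cvg.
  near=> y; rewrite gE//; near: y.
  exact: (@near_in_itvoo _ (-N) N x xE).
- have mUv : measurable_fun [set: R] (fun x => u x - v x) by exact: measurable_funB.
  have mvg : measurable_fun [set: R] (fun x => v x - g x) by exact: measurable_funB.
  have mug : measurable_fun [set: R] (fun x => u x - g x) by exact: measurable_funB.
  apply: (le_trans (sqint_leD _ _ _ mUv mvg mug _)); first by move=> x; ring.
  have vg : (sqint (fun x => v x - g x)%R <= (d / 4)%:E)%E.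
    apply: (@le_trans _ _ ((2 * m)%:E * \int[mu]_(z in E) `|(v z - h k z)%:E|)%E).
      rewrite integral_mkcond -ge0_integralZl//; last 3 first.
      + apply/(measurable_restrictT _ mE); apply: measurable_funTS; apply: measurableT_comp => //.
        by apply/measurable_EFinP; exact: measurable_funB.
      + by move=> x _; rewrite patchE; case: ifP.
      + by rewrite lee_fin mulr_ge0// ltW.
      apply: ge0_le_integral => //.
      + by move=> x _; rewrite lee_fin sqr_ge0.
      + exact: measurable_sqr.
      + apply: measurable_funeM; apply/(measurable_restrictT _ mE); apply: measurable_funTS;
          apply: measurableT_comp => //.
        by apply/measurable_EFinP; exact: measurable_funB.
      + move=> x _; rewrite patchE.
        have [xE|xE] := boolP (x \in `]-N, N[); last first.
          rewrite v0// g0// subrr expr0n mule_ge0//; first by rewrite lee_fin mulr_ge0// ltW.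
          by case: ifP.
        rewrite mem_set// gE// -EFinM lee_fin -[leLHS]real_normK ?num_real// expr2.
        apply: ler_pM => //.
          rewrite (le_trans (ler_normB _ _))// mulr_natl mulr2n lerD//; exact: clip_le (ltW m0).
        by rewrite -{1}(clip_id m (v x)) ?clip_le ?(ltW m0)//; exact: clip_lipschitz (ltW m0).
    apply: (@le_trans _ _ ((2 * m)%:E * d'%:E)%E).
      by rewrite lee_wpmul2l// lee_fin mulr_ge0// ltW.
    by rewrite -EFinM lee_fin /d' mulrC divfK// gt_eqF// mulr_gt0.
  apply: (@le_trans _ _ (2%:E * (d / 4)%:E + 2%:E * (d / 4)%:E)%E).
    by apply: leeD; rewrite lee_wpmul2l.
  by rewrite -!EFinM -EFinD lee_fin; lra.
Unshelve. all: by end_near. Qed.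

End compact_plancherel.

(** * Plancherel's identity for functions with bounded support *)

Section plancherel_compact.
Context {R : realType}.
Notation mu := (@lebesgue_measure R).

Lemma trigBZ (k u v : R -> R) (c p : R) :
  measurable_fun [set: R] k -> (forall x, `|k x| <= 1) ->
  mu.-integrable setT (EFin \o u) -> mu.-integrable setT (EFin \o v) ->
  trig k (fun x => u x - c * v x) p = trig k u p - c * trig k v p.
Proof.
move=> mk k1 iu iv; rewrite /trig.
have ik := integrable_mul_kernel k mk k1 u p iu.
have ikv := integrable_mul_kernel k mk k1 v p iv.
rewrite -RintegralZl// -RintegralB//; last exact: (integrableZl measurableT c ikv).
by apply: eq_Rintegral => x _; ring.
Qed.

Lemma integrableBZ (u v : R -> R) (c : R) :
  mu.-integrable setT (EFin \o u) -> mu.-integrable setT (EFin \o v) ->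
  mu.-integrable setT (EFin \o (fun x => u x - c * v x)).
Proof.
move=> iu iv; have := integrableB measurableT iu (integrableZl measurableT c iv).
by apply: eq_integrable.
Qed.

Lemma sqint_finB (u v : R -> R) : measurable_fun [set: R] u -> measurable_fun [set: R] v ->
  (sqint u < +oo)%E -> (sqint v < +oo)%E -> (sqint (fun x => u x - v x)%R < +oo)%E.
Proof.
move=> mU mV uoo voo.
have mNV : measurable_fun [set: R] (fun x => - v x) by exact: measurableT_comp.
apply: le_lt_trans (sqint_leD u (fun x => - v x) _ _ _ _ _) _ => //.
  exact: measurable_funB.
have -> : sqint (fun x => - v x) = sqint v by apply: eq_integral => x _; rewrite sqrrN.
by rewrite lte_add_pinfty// lte_mul_pinfty.
Qed.

(** Let Q (v) be the nonnegative defect in Bessel's inequality.  If Q (g) <= 0, the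
    parallelogram law for Q yields
      Q (u) <= Q (u) + Q (u - 2 g) = 2 Q (u - g) + 2 Q (g) <= 2 Q (u - g),
    which is small when g is close to u in L2. *)
Lemma plancherel_compact (u : R -> R) (N : R) :
  measurable_fun [set: R] u -> (sqint u < +oo)%E ->
  (forall x, x \notin `]-N, N[ -> u x = 0) ->
  mu.-integrable setT (EFin \o u) /\
  (\int[mu]_p (trig_power u p)%:E = (2 * pi)%:E * sqint u)%E.
Proof.
move=> mU uoo u0.
have iu : mu.-integrable setT (EFin \o u).
  have mE : measurable (`]-N, N[%classic : set R) by [].
  have i1 : mu.-integrable setT (EFin \o (\1_(`]-N, N[%classic : set R) : R -> R)).
    apply: (integrable_bounded_support N _ 1); first exact: measurable_indic.
      by move=> x; rewrite indicE; case: (_ \in _); rewrite ?normr1 ?normr0.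
    by move=> x xE; rewrite indicE memNset//; exact/negP.
  have := integrableD measurableT i1 (integrable_sqr u mU uoo).
  apply: le_integrable => //; first exact/measurable_EFinP.
  move=> x _; rewrite /= lee_fin indicE.
  have [xE|xE] := boolP (x \in `]-N, N[); last by rewrite u0// normr0.
  rewrite mem_set// [leRHS]ger0_norm ?addr_ge0 ?sqr_ge0//.
  rewrite -(real_normK (num_real (u x))).
  have := sqr_ge0 (`|u x| - 1); have := sqr_ge0 (`|u x|); rewrite -[true%:R]/(1 : R); lra.
split => //; apply/eqP; rewrite eq_le bessel//=; apply/lee_addgt0Pr => d d0.
have c0 : 0 < 2 * pi :> R by rewrite mulr_gt0// pi_gt0.
(* The defect of u is at most 2 (2 pi) d'. *)
pose d' := d / (2 * (2 * pi)).
have d'0 : 0 < d' by rewrite divr_gt0// mulr_gt0.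
have [g [m [ig gm gc gu]]] := L2_dense u N d' d'0 mU uoo u0.
have mg : measurable_fun [set: R] g by apply/measurable_EFinP; exact: measurable_int ig.
have goo : (sqint g < +oo)%E.
  have mug : measurable_fun [set: R] (fun x => g x - u x) by exact: measurable_funB.
  apply: le_lt_trans (sqint_leD (fun x => g x - u x) u g mug mU mg _) _.
    by move=> x; ring.
  rewrite lte_add_pinfty// lte_mul_pinfty//; apply: le_lt_trans (ltry d').
  apply: le_trans gu; rewrite le_eqVlt; apply/orP; left; apply/eqP.
  by apply: eq_integral => x _; rewrite -sqrrN opprB.
have iw : mu.-integrable setT (EFin \o (fun x => u x - 2 * g x)) by exact: integrableBZ.
pose w x := u x - 2 * g x.
have mw : measurable_fun [set: R] w by apply/measurable_EFinP; exact: measurable_int iw.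
have woo : (sqint w < +oo)%E.
  apply: (@sqint_finB u (fun x => 2 * g x)) => //; first exact: measurable_funM.
  rewrite (_ : sqint _ = (2 ^+ 2)%:E * sqint g)%E ?lte_mul_pinfty ?lee_fin ?sqr_ge0//.
  rewrite /sqint -ge0_integralZl//; last 2 first.
  - exact: measurable_sqr.
  - by move=> x _; rewrite lee_fin sqr_ge0.
  by apply: eq_integral => x _; rewrite exprMn EFinM.
have par : (sqint u + sqint w = 2%:E * sqint (fun x => u x - g x)%R + 2%:E * sqint g)%E.
  have mug : measurable_fun [set: R] (fun x => u x - g x) by exact: measurable_funB.
  have m1 : measurable_fun [set: R] (fun x => 2%:E * ((u x - g x) ^+ 2)%:E)%E.
    by apply: measurable_funeM; apply: measurable_sqr.
  have m2 : measurable_fun [set: R] (fun x => 2%:E * ((g x) ^+ 2)%:E)%E.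
    by apply: measurable_funeM; apply: measurable_sqr.
  rewrite /sqint -!ge0_integralZl//; try exact: measurable_sqr;
    try by (move=> x _; rewrite lee_fin sqr_ge0).
  rewrite -!ge0_integralD//; try exact: measurable_sqr;
    try by (move=> x _; rewrite ?mule_ge0 ?lee_fin ?sqr_ge0);
    try exact: m1; try exact: m2.
  by apply: eq_integral => x _; rewrite -!EFinM -!EFinD /w; congr EFin; ring.
pose energy v := (\int[mu]_p (trig_power v p)%:E)%E.
have par2 : (2%:E * energy g <= energy u + energy w)%E.
  have t0 v p : [set: R] p -> (0 <= (trig_power v p)%:E)%E.
    by move=> _; rewrite lee_fin trig_power_ge0.
  have mt v : mu.-integrable setT (EFin \o v) ->
    measurable_fun [set: R] (fun p => (trig_power v p)%:E).
    by move=> iv; apply/measurable_EFinP; exact: measurable_trig_power.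
  rewrite /energy -ge0_integralZl//; try (by apply: mt); try by (move=> x _; exact: t0).
  rewrite -ge0_integralD//; try (by apply: mt); try by (move=> x _; exact: t0).
  apply: ge0_le_integral => //.
  - by move=> p _; rewrite mule_ge0 ?t0.
  - by apply: measurable_funeM; exact: (mt g ig).
  - by apply: emeasurable_funD; apply: mt.
  - move=> p _; rewrite -EFinM -EFinD lee_fin /trig_power /w.
    rewrite (trigBZ cos)//; [|exact: measurable_cos|exact: cos_max].
    rewrite (trigBZ sin)//; [|exact: measurable_sin|exact: sin_max].
    have := sqr_ge0 (trig cos u p - trig cos g p).
    have := sqr_ge0 (trig sin u p - trig sin g p). nra.
have cw : ((2 * pi)%:E * sqint w)%E \is a fin_num.
  by rewrite fin_numM// ge0_fin_numE ?sqint_ge0.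
suff : ((2 * pi)%:E * sqint u + (2 * pi)%:E * sqint w <= energy u + d%:E + (2 * pi)%:E * sqint
  w)%E.
  by rewrite leeD2rE.
rewrite -ge0_muleDr ?sqint_ge0// par.
apply: (@le_trans _ _ (d%:E + 2%:E * energy g)%E).
  rewrite ge0_muleDr ?mule_ge0 ?sqint_ge0// ; apply: leeD.
    apply: (@le_trans _ _ ((2 * pi)%:E * (2%:E * d'%:E))%E).
      by apply: lee_wpmul2l; [rewrite lee_fin ltW|exact: lee_wpmul2l].
    rewrite -!EFinM lee_fin /d'.
    have -> : 2 * pi * (2 * (d / (2 * (2 * pi)))) = d by move: c0; set c := 2 * pi => c0; field;
      rewrite gt_eqF.
    by [].
  by rewrite muleCA lee_wpmul2l//; exact: (plancherel_ge g m).
apply: (@le_trans _ _ (d%:E + (energy u + energy w))%E); first exact: leeD2l.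
by rewrite addeA (addeC d%:E) leeD2l//; exact: bessel.
Qed.

End plancherel_compact.

(** * Fourier transforms of truncated functions *)

Section fourier.
Context {R : realType}.
Notation mu := (@lebesgue_measure R).
Local Open Scope complex_scope.

Definition csqint (psi : R -> R[i]) : \bar R := (\int[mu]_p (cmod (psi p) ^+ 2)%:E)%E.

Definition measurable_complex (psi : R -> R[i]) : Prop :=
  measurable_fun [set: R] (fun p => complex.Re (psi p)) /\
  measurable_fun [set: R] (fun p => complex.Im (psi p)).

Lemma cmod_sqr (z : R[i]) : cmod z ^+ 2 = complex.Re z ^+ 2 + complex.Im z ^+ 2.
Proof. by case: z => x y; rewrite /cmod /= sqr_sqrtr// addr_ge0 ?sqr_ge0. Qed.

Lemma measurable_cmod_sqr (psi : R -> R[i]) : measurable_complex psi ->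
  measurable_fun [set: R] (fun p => (cmod (psi p) ^+ 2)%:E).
Proof.
move=> [mr mi]; apply/measurable_EFinP; under eq_fun do rewrite cmod_sqr.
by apply: measurable_funD; exact: measurable_funX.
Qed.

Lemma measurable_complexB (psi phi : R -> R[i]) : measurable_complex psi ->
  measurable_complex phi ->
  measurable_complex (fun p => psi p - phi p).
Proof.
move=> [r1 i1] [r2 i2]; split.
  rewrite (_ : (fun _ => _) = (fun p => complex.Re (psi p) - complex.Re (phi p))).
    exact: measurable_funB.
  by apply/funext => p; case: (psi p) => a b; case: (phi p).
rewrite (_ : (fun _ => _) = (fun p => complex.Im (psi p) - complex.Im (phi p))).
  exact: measurable_funB.
by apply/funext => p; case: (psi p) => a b; case: (phi p).
Qed.

Lemma csqint_ge0 (psi : R -> R[i]) : (0 <= csqint psi)%E.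
Proof. by apply: integral_ge0 => p _; rewrite lee_fin sqr_ge0. Qed.

Lemma csqintBC (psi phi : R -> R[i]) :
  csqint (fun p => psi p - phi p) = csqint (fun p => phi p - psi p).
Proof.
apply: eq_integral => p _; rewrite !cmod_sqr.
by case: (psi p) => a b; case: (phi p) => c d; congr EFin => /=; ring.
Qed.

(** From x^2 <= (1 + t) y^2 + (1 + 1/t) (x - y)^2.  This form of the triangle
    inequality avoids square roots of extended reals; the factor 1 + t may be taken
    as close to 1 as desired once psi - phi is small. *)
Lemma csqint_le (psi phi : R -> R[i]) (t : R) : 0 < t ->
  measurable_complex psi -> measurable_complex phi ->
  (csqint psi <= (1 + t)%:E * csqint phi + (1 + t^-1)%:E * csqint (fun p => psi p - phi p)%R)%E.
Proof.
move=> t0 m1 m2; have m12 := measurable_complexB psi phi m1 m2.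
have t1 : 0 <= 1 + t by rewrite addr_ge0// ltW.
have t2 : 0 <= 1 + t^-1 by rewrite addr_ge0// invr_ge0 ltW.
have n1 := measurable_cmod_sqr _ m1.
have n2 := measurable_cmod_sqr _ m2.
have n12 := measurable_cmod_sqr _ m12.
rewrite /csqint -!ge0_integralZl ?lee_fin//; try by (move=> x _; rewrite lee_fin sqr_ge0).
rewrite -ge0_integralD//; try (by move=> x _; rewrite mule_ge0 ?lee_fin ?sqr_ge0);
  try by apply: measurable_funeM.
apply: ge0_le_integral => //; try by (move=> x _; rewrite lee_fin sqr_ge0).
- by apply: emeasurable_funD; exact: measurable_funeM.
- move=> p _; rewrite -!EFinM -EFinD lee_fin !cmod_sqr.
  case: (psi p) => a b; case: (phi p) => c d /=.
  have key (x y : R) : x ^+ 2 <= (1 + t) * y ^+ 2 + (1 + t^-1) * (x - y) ^+ 2.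
    rewrite -subr_ge0.
    have -> : (1 + t) * y ^+ 2 + (1 + t^-1) * (x - y) ^+ 2 - x ^+ 2 = t^-1 * (t * y - (x - y)) ^+
      2.
      by field; rewrite gt_eqF.
    by rewrite mulr_ge0 ?sqr_ge0// invr_ge0 ltW.
  by have := key a c; have := key b d; lra.
Qed.

Lemma fourier_L1E (v : R -> R) (p : R) : fourier_L1 v p =
  Complex ((Num.sqrt (2 * pi))^-1 * trig cos v p) (- ((Num.sqrt (2 * pi))^-1 * trig sin v p)).
Proof. by rewrite /fourier_L1 /GRing.mul/= !mul0r subr0 addr0 mulrN. Qed.

Lemma cmod_fourier_L1 (v : R -> R) (p : R) :
  cmod (fourier_L1 v p) ^+ 2 = (2 * pi)^-1 * trig_power v p.
Proof.
rewrite fourier_L1E cmod_sqr/= sqrrN !exprMn -mulrDr exprVn sqr_sqrtr//.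
by rewrite mulr_ge0// pi_ge0.
Qed.

Lemma measurable_fourier_L1 (v : R -> R) : mu.-integrable setT (EFin \o v) ->
  measurable_complex (fourier_L1 v).
Proof.
move=> iv; split; under eq_fun do rewrite fourier_L1E/=.
  apply: measurable_funM => //; apply: measurable_trig => //;
    [exact: measurable_cos|exact: cos_max].
apply: measurableT_comp => //; apply: measurable_funM => //.
apply: measurable_trig => //; [exact: measurable_sin|exact: sin_max].
Qed.

Lemma measurable_truncate n (u : R -> R) : measurable_fun [set: R] u ->
  measurable_fun [set: R] (truncate n u).
Proof. by move=> mU; apply: measurable_funM => //; exact: measurable_indic. Qed.

Lemma truncate_sqr_le n (u : R -> R) x : (truncate n u x) ^+ 2 <= u x ^+ 2.
Proof.
rewrite /truncate indicE; case: (x \in _); rewrite ?mulr1// mulr0 expr0n sqr_ge0//.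
Qed.

Lemma sqint_truncate_le n (u : R -> R) : measurable_fun [set: R] u ->
  (sqint (truncate n u) <= sqint u)%E.
Proof.
move=> mU; apply: ge0_le_integral => //.
- by move=> x _; rewrite lee_fin sqr_ge0.
- by apply: measurable_sqr; exact: measurable_truncate.
- exact: measurable_sqr.
- by move=> x _; rewrite lee_fin truncate_sqr_le.
Qed.

Lemma plancherel_truncate n (u : R -> R) :
  measurable_fun [set: R] u -> (sqint u < +oo)%E ->
  mu.-integrable setT (EFin \o truncate n u) /\
  csqint (fourier_L1 (truncate n u)) = sqint (truncate n u).
Proof.
move=> mU uoo.
have [|||iu P] := plancherel_compact (truncate n u) n.+1%:R.
- exact: measurable_truncate.
- exact: le_lt_trans (sqint_truncate_le n u mU) uoo.
- move=> x; rewrite in_itv/= => xn.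
  rewrite /truncate indicE memNset ?mulr0//= in_itv/= => /andP[nx xn'].
  move: xn; apply/negP; rewrite negbK.
  rewrite (lt_le_trans _ nx) ?ltrN2 ?ltr_nat//=.
  by rewrite (le_lt_trans xn') ?ltr_nat.
split => //.
have c0 : 0 < 2 * pi :> R by rewrite mulr_gt0// pi_gt0.
rewrite /csqint; under eq_integral do rewrite cmod_fourier_L1 EFinM.
rewrite ge0_integralZl//.
- by rewrite P muleA -EFinM mulVf ?mul1e// gt_eqF.
- by apply/measurable_EFinP; exact: measurable_trig_power.
- by move=> p _; rewrite lee_fin trig_power_ge0.
- by rewrite lee_fin invr_ge0 ltW.
Qed.

Lemma cvg_sqint_truncate (u : R -> R) : measurable_fun [set: R] u ->
  (sqint u < +oo)%E -> sqint (truncate n u) @[n --> \oo] --> sqint u.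
Proof.
move=> mU uoo.
have [|||||_ _ //] := @dominated_convergence _ _ _ mu setT measurableT
  (fun n x => ((truncate n u x) ^+ 2)%:E) (fun x => ((u x) ^+ 2)%:E) (fun x => ((u x) ^+ 2)%:E).
- by move=> n; apply: measurable_sqr; exact: measurable_truncate.
- exact: measurable_sqr.
- apply/nearW => x _; apply: cvg_near_cst; near=> n.
  rewrite /truncate indicE mem_set ?mulr1//= in_itv/=.
  rewrite -ler_norml; near: n; exact: nbhs_infty_ger.
- exact: integrable_sqr.
- by apply/nearW => x n _; rewrite /= ger0_norm ?sqr_ge0// lee_fin truncate_sqr_le.
Unshelve. all: by end_near. Qed.

End fourier.

(** * Plancherel's theorem in L2 *)

Section isometry.
Context {R : realType}.
Notation mu := (@lebesgue_measure R).
Local Open Scope complex_scope.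

(** Serves to let both error terms that [csqint_le] produces tend to 0; the bound is
    void if S is infinite. *)
Lemma le_of_relative_error (A S : \bar R) : (0 <= S)%E ->
  (forall t e : R, 0 < t -> 0 < e -> (A <= (1 + t)%:E * S + e%:E)%E) -> (A <= S)%E.
Proof.
move=> S0 h; move: S S0 h => [s| |] // s0 h; last by rewrite leey.
apply/lee_addgt0Pr => e e0.
have t0 : 0 < e / 2 / (s + 1) by rewrite !divr_gt0// ltr_wpDl.
have e20 : 0 < e / 2 by rewrite divr_gt0.
apply: le_trans (h _ _ t0 e20) _.
rewrite -EFinM -!EFinD lee_fin mulrDl mul1r -addrA lerD2l.
have : e / 2 / (s + 1) * s <= e / 2.
  by rewrite mulrAC ler_pdivrMr ?ltr_wpDl// ler_wpM2l ?(ltW e20)// lerDl.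
lra.
Qed.

(** What Plancherel's theorem uses of [is_fourier]: of the transform only
    measurability is required, its square integrability being a consequence. *)
Definition fourier_pair (u : R -> R) (psi : R -> R[i]) : Prop :=
  [/\ measurable_fun [set: R] u, (sqint u < +oo)%E, measurable_complex psi &
   (csqint (fun p => fourier_L1 (truncate n u) p - psi p)%R @[n --> \oo] --> 0%E)].

(** The transforms of the truncations converge in L2 to psi, and their energies are
    those of the truncations, which converge to that of u. *)
Lemma plancherel (u : R -> R) (psi : R -> R[i]) : fourier_pair u psi -> csqint psi = sqint u.
Proof.
move=> [mU uoo mpsi h].
have T n := plancherel_truncate n u mU uoo.
have mF n := measurable_fourier_L1 _ (T n).1.
have small (c e : R) : 0 < c -> 0 < e -> \forall n \near \oo,
    (c%:E * csqint (fun p => fourier_L1 (truncate n u) p - psi p)%R <= e%:E)%E.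
  move=> c0 e0.
  have /fine_cvgP[hf] := h; move=> /cvgrPdist_le /(_ (e / c) (divr_gt0 e0 c0)) hc.
  near=> n.
  have fn : csqint (fun p => fourier_L1 (truncate n u) p - psi p) \is a fin_num by near: n.
  rewrite -(fineK fn) -EFinM lee_fin mulrC -ler_pdivlMr//.
  rewrite (le_trans (ler_norm _))// -normrN -[X in `|X|]add0r.
  by near: n.
have up : (csqint psi <= sqint u)%E.
  apply: le_of_relative_error; first exact: sqint_ge0.
  move=> t e t0 e0.
  have t10 : 0 < 1 + t^-1 by rewrite addr_gt0// invr_gt0.
  have [n _ /(_ n (leqnn n)) hn] := small _ _ t10 e0.
  apply: (le_trans (csqint_le psi (fourier_L1 (truncate n u)) t t0 mpsi (mF n))).
  rewrite csqintBC; apply: leeD => //.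
  rewrite (T n).2; apply: lee_wpmul2l; last exact: sqint_truncate_le.
  by rewrite lee_fin addr_ge0// ltW.
apply/eqP; rewrite eq_le up/=.
apply: le_of_relative_error; first exact: csqint_ge0.
move=> t e t0 e0.
have t10 : 0 < 1 + t^-1 by rewrite addr_gt0// invr_gt0.
have hu := cvg_sqint_truncate u mU uoo.
rewrite -(cvg_lim _ hu)//; apply: lime_le; first by apply/cvg_ex; eexists; exact: hu.
near=> n.
rewrite -(T n).2; apply: (le_trans (csqint_le _ psi t t0 (mF n) mpsi)).
by apply: leeD => //; near: n; exact: small.
Unshelve. all: by end_near. Qed.

Lemma fourier_L1B (u v : R -> R) p : mu.-integrable setT (EFin \o u) ->
  mu.-integrable setT (EFin \o v) ->
  fourier_L1 (fun x => u x - v x) p = fourier_L1 u p - fourier_L1 v p.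
Proof.
move=> iu iv.
have -> : (fun x => u x - v x) = (fun x => u x - 1 * v x) by apply/funext => x; rewrite mul1r.
rewrite !fourier_L1E !trigBZ//;
  [|exact: measurable_sin|exact: sin_max|exact: measurable_cos|exact: cos_max].
by rewrite !mul1r; apply/eqP; rewrite eq_complex/=; apply/andP; split; apply/eqP; ring.
Qed.

Lemma fourier_pairB (u v : R -> R) (psi phi : R -> R[i]) :
  fourier_pair u psi -> fourier_pair v phi ->
  fourier_pair (fun x => u x - v x) (fun p => psi p - phi p).
Proof.
move=> [mU uoo mpsi hu] [mV voo mphi hv].
split; [exact: measurable_funB|exact: sqint_finB|exact: measurable_complexB|].
have Tu n := plancherel_truncate n u mU uoo.
have Tv n := plancherel_truncate n v mV voo.
have mFu n := measurable_fourier_L1 _ (Tu n).1.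
have mFv n := measurable_fourier_L1 _ (Tv n).1.
pose a n := csqint (fun p => fourier_L1 (truncate n u) p - psi p)%R.
pose b n := csqint (fun p => fourier_L1 (truncate n v) p - phi p)%R.
apply: (@squeeze_cvge _ _ _ _ (cst 0%E) _ (fun n => 2%:E * a n + 2%:E * b n)%E).
- apply: nearW => n; rewrite csqint_ge0/=.
  have m1 := measurable_complexB _ _ (mFu n) mpsi.
  have m2 := measurable_complexB _ _ (mFv n) mphi.
  have -> : csqint (fun p => fourier_L1 (truncate n (fun x => u x - v x)) p - (psi p - phi p)) =
      csqint (fun p => (fourier_L1 (truncate n u) p - psi p) - (fourier_L1 (truncate n v) p - phi
        p)).
    apply: eq_integral => p _; congr ((cmod _) ^+ 2)%:E.
    rewrite (_ : truncate n _ = fun x => truncate n u x - truncate n v x).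
      by rewrite (fourier_L1B _ _ _ (Tu n).1 (Tv n).1); ring.
    by apply/funext => x; rewrite /truncate mulrBl.
  apply: (le_trans (csqint_le _ _ 1 ltr01 (measurable_complexB _ _ m1 m2) m1)).
  rewrite invr1 -[1 + 1]/2; apply: leeD => //; apply: lee_wpmul2l => //.
  rewrite /b le_eqVlt; apply/orP; left; apply/eqP; apply: eq_integral => p _.
  by rewrite !cmod_sqr; case: (fourier_L1 _ _) => ? ?; case: (psi p) => ? ?;
     case: (fourier_L1 _ _) => ? ?; case: (phi p) => ? ?; congr EFin => /=; ring.
- exact: cvg_cst.
- suff : (2%:E * a n + 2%:E * b n)%E @[n --> \oo] --> (2%:E * 0 + 2%:E * 0)%E.
    by rewrite mule0 adde0.
  by apply: cvgeD => //; [apply: (cvgeZl _ hu)|apply: (cvgeZl _ hv)].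
Qed.

End isometry.

(** * The L2 norm *)

Section norms.
Context {R : realType}.
Notation mu := (@lebesgue_measure R).

Lemma ae_imply (P Q : R -> Prop) : (forall x, P x -> Q x) ->
  {ae mu, forall x, P x} -> {ae mu, forall x, Q x}.
Proof. by move=> PQ; apply: (@filterS _ _ (ae_filter_ringOfSetsType mu)). Qed.

Lemma ae_imply2 (P Q S : R -> Prop) : (forall x, P x -> Q x -> S x) ->
  {ae mu, forall x, P x} -> {ae mu, forall x, Q x} -> {ae mu, forall x, S x}.
Proof. by move=> PQ; apply: (@filterS2 _ _ (ae_filter_ringOfSetsType mu)). Qed.

Lemma sqint_poweR (u : R -> R) : sqint u = (norm_Lp 2%:E u `^ 2)%E.
Proof.
rewrite /norm_Lp poweR_Lnorm//; apply: eq_integral => x _ /=.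
by rewrite powR_mulrn// real_normK// num_real.
Qed.

Lemma norm_Lp_sqint (u : R -> R) : norm_Lp 2%:E u = (sqint u `^ 2^-1)%E.
Proof. by rewrite sqint_poweR -poweRrM divff// poweRe1// Lnorm_ge0. Qed.

Lemma norm_Lp_ge0 p (u : R -> R) : (0 <= norm_Lp p u)%E.
Proof. exact: Lnorm_ge0. Qed.

Lemma mem_itv0y (x : \bar R) : (0 <= x)%E -> x \in `[0%E, +oo%E].
Proof. by move=> x0; rewrite in_itv/= x0 leey. Qed.

Lemma norm_Lp2_le (u v : R -> R) (c : R) : 0 <= c ->
  (sqint u <= (c ^+ 2)%:E * sqint v)%E -> (norm_Lp 2%:E u <= c%:E * norm_Lp 2%:E v)%E.
Proof.
move=> c0 h; rewrite !norm_Lp_sqint.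
have -> : (c%:E * (sqint v `^ 2^-1) = ((c ^+ 2)%:E * sqint v) `^ 2^-1)%E.
  rewrite poweRM ?lee_fin ?sqr_ge0 ?sqint_ge0//; congr (_ * _)%E.
  by rewrite poweR_EFin powR12_sqrt ?sqr_ge0// sqrtr_sqr ger0_norm.
apply: gt0_ler_poweR => //; apply: mem_itv0y; first exact: sqint_ge0.
by rewrite mule_ge0 ?sqint_ge0// lee_fin sqr_ge0.
Qed.

Lemma Lp2P (u : R -> R) : u \in Lp 2%:E ->
  measurable_fun [set: R] u /\ (sqint u < +oo)%E.
Proof.
rewrite inE => /andP[]; rewrite !inE/= => mU uoo; split => //.
rewrite sqint_poweR; move: uoo; rewrite /finite_norm -/(norm_Lp _ _).
have := norm_Lp_ge0 2%:E u.
by case: (norm_Lp 2%:E u) => [r| |]// _ _; rewrite poweR_EFin ltry.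
Qed.

Lemma sqint_scale (u v : R -> R) (c : R) : measurable_fun [set: R] u ->
  measurable_fun [set: R] v ->
  (forall x, `|u x| <= c * `|v x|) -> (sqint u <= (c ^+ 2)%:E * sqint v)%E.
Proof.
move=> mU mV uv.
rewrite /sqint -ge0_integralZl//; try exact: measurable_sqr;
  try (by move=> x _; rewrite lee_fin sqr_ge0); try (by rewrite lee_fin sqr_ge0).
apply: ge0_le_integral => //.
- by move=> x _; rewrite lee_fin sqr_ge0.
- exact: measurable_sqr.
- by apply: measurable_funeM; exact: measurable_sqr.
- move=> x _; rewrite -EFinM lee_fin -[leLHS]real_normK ?num_real// -[v x ^+ 2]real_normK
    ?num_real// -exprMn.
  by rewrite lerXn2r ?nnegrE// (le_trans _ (uv x)).
Qed.

Lemma norm_Lp2_lin (w u v : R -> R) (a b : R) : 0 <= a -> 0 <= b ->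
  measurable_fun [set: R] w -> measurable_fun [set: R] u -> measurable_fun [set: R] v ->
  (forall x, `|w x| <= a * `|u x| + b * `|v x|) ->
  (norm_Lp 2%:E w <= a%:E * norm_Lp 2%:E u + b%:E * norm_Lp 2%:E v)%E.
Proof.
move=> a0 b0 mw mU mV h.
pose u' x := a * `|u x|; pose v' x := b * `|v x|.
have mu1 : measurable_fun [set: R] u' by apply: measurable_funM => //; exact: measurableT_comp.
have mv1 : measurable_fun [set: R] v' by apply: measurable_funM => //; exact: measurableT_comp.
have u'0 x : 0 <= u' x by rewrite mulr_ge0.
have v'0 x : 0 <= v' x by rewrite mulr_ge0.
apply: (@le_trans _ _ (norm_Lp 2%:E (fun x => (u' x + v' x)%R))).
  rewrite -[leRHS]mul1e; apply: norm_Lp2_le => //; apply: sqint_scale => //.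
    exact: measurable_funD.
  by move=> x; rewrite mul1r [leRHS]ger0_norm ?addr_ge0//; exact: h.
have : (norm_Lp 2%:E (u' \+ v')%R <= norm_Lp 2%:E u' + norm_Lp 2%:E v')%E.
  by apply: minkowski_EFin => //; rewrite ler1n.
move/le_trans; apply; apply: leeD; apply: norm_Lp2_le => //; apply: sqint_scale => // x.
  by rewrite [leLHS]ger0_norm.
by rewrite [leLHS]ger0_norm.
Qed.

(** Hoelder's inequality for |K|^(1/2) and |K|^(1/2) |w|. *)
Lemma cauchy_schwarz_kernel (K w : R -> R) (x : R) :
  measurable_fun [set: R] K -> measurable_fun [set: R] w ->
  ((\int[mu]_y (`|K (x - y)| * `|w y|)%:E) `^ 2 <=
   (\int[mu]_y (`|K y|)%:E) * \int[mu]_y (`|K (x - y)| * w y ^+ 2)%:E)%E.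
Proof.
move=> mK mw.
have mKx : measurable_fun [set: R] (fun y => K (x - y)).
  by apply: (measurableT_comp mK); exact: measurable_funB.
pose f y := Num.sqrt `|K (x - y)|; pose g y := Num.sqrt `|K (x - y)| * `|w y|.
have mf : measurable_fun [set: R] f.
  have ms : measurable_fun [set: R] (@Num.sqrt R).
    by apply: continuous_measurable_fun; exact: sqrt_continuous.
  by apply: (measurableT_comp ms); exact: measurableT_comp.
have mg : measurable_fun [set: R] g by apply: measurable_funM => //; exact: measurableT_comp.
have half2 : 2^-1 + 2^-1 = 1 :> R by field.
have := hoelder mu mf mg (ltr0n _ 2) (ltr0n _ 2) half2.
rewrite Lnorm1 => h.
have {}h : (\int[mu]_y (`|K (x - y)| * `|w y|)%:E <= norm_Lp 2%:E f * norm_Lp 2%:E g)%E.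
  apply: le_trans h; rewrite le_eqVlt; apply/orP; left; apply/eqP.
  apply: eq_integral => y _ /=; congr EFin.
  by rewrite /f /g mulrA -expr2 sqr_sqrtr// [RHS]ger0_norm// mulr_ge0.
have h2 : (0 : R) <= 2 by [].
have := gt0_ler_poweR h2 (mem_itv0y _ _) (mem_itv0y _ _) h.
rewrite poweRM ?norm_Lp_ge0// -!sqint_poweR => h3.
apply: (le_trans (h3 _ _)); first by apply: integral_ge0 => y _; rewrite lee_fin mulr_ge0.
  by rewrite mule_ge0 ?norm_Lp_ge0.
rewrite le_eqVlt; apply/orP; left; apply/eqP; congr (_ * _)%E.
  rewrite (ge0_integral_affine (-1) x) ?oppr_eq0 ?oner_eq0//; last first.
    by apply/measurable_EFinP; exact: measurableT_comp.
  rewrite normrN normr1 mul1e; apply: eq_integral => y _.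
  by rewrite sqr_sqrtr// mulN1r addrC.
apply: eq_integral => y _; congr EFin.
by rewrite exprMn sqr_sqrtr// real_normK// num_real.
Qed.

End norms.

(** * Young's inequality *)

Section young.
Context {R : realType}.
Notation mu := (@lebesgue_measure R).

Variable K : R -> R.
Hypothesis iK : mu.-integrable setT (EFin \o K).

Let mK : measurable_fun [set: R] K.
Proof. by apply/measurable_EFinP; exact: measurable_int iK. Qed.

Let k := \int[mu]_y `|K y|.

Let kE : (\int[mu]_y (`|K y|)%:E = k%:E)%E.
Proof. by rewrite /k /Rintegral fineK//; apply: integrable_fin_num => //;
  exact: (integrable_abse iK). Qed.

Let k0 : 0 <= k. Proof. exact: Rintegral_ge0. Qed.

Let A (w : R -> R) (x : R) : \bar R := (\int[mu]_y (`|K (x - y)| * `|w y|)%:E)%E.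

Let A0 w x : (0 <= A w x)%E.
Proof. by apply: integral_ge0 => y _; rewrite lee_fin mulr_ge0. Qed.

Let mKB : measurable_fun [set: measurableTypeR R * measurableTypeR R] (fun z => K (z.1 - z.2)).
Proof. by apply: (measurableT_comp mK); exact: measurable_funB. Qed.

Let mA w : measurable_fun [set: R] w -> measurable_fun [set: R] (A w).
Proof.
move=> mw; apply: (measurable_integral2 (fun z => (`|K (z.1 - z.2)| * `|w z.2|)%:E)).
  apply/measurable_EFinP; apply: measurable_funM; first exact: measurableT_comp.
  by apply: measurableT_comp => //; exact: (measurableT_comp mw).
by move=> z; rewrite lee_fin mulr_ge0.
Qed.

Let mA2 w : measurable_fun [set: R] w -> measurable_fun [set: R] (fun x => A w x `^ 2)%E.
Proof. by move=> mw; apply: (measurableT_comp (measurable_poweR 2)); exact: mA. Qed.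

(** Cauchy-Schwarz in y, then integration in x first. *)
Let young_abs w : measurable_fun [set: R] w ->
  (\int[mu]_x (A w x `^ 2) <= (k ^+ 2)%:E * sqint w)%E.
Proof.
move=> mw.
pose F (z : measurableTypeR R * measurableTypeR R) : \bar R := (`|K (z.1 - z.2)| * w z.2 ^+ 2)%:E.
have F0 z : (0 <= F z)%E by rewrite lee_fin mulr_ge0 ?sqr_ge0.
have mF : measurable_fun setT F.
  apply/measurable_EFinP; apply: measurable_funM; first exact: measurableT_comp.
  by apply: measurable_funX; exact: (measurableT_comp mw).
apply: (@le_trans _ _ (\int[mu]_x (k%:E * \int[mu]_y F (x, y)))%E).
  apply: ge0_le_integral => //.
  - by move=> x _; exact: poweR_ge0.
  - exact: mA2.
  - by apply: measurable_funeM; exact: measurable_integral2.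
  - by move=> x _; rewrite -kE; exact: cauchy_schwarz_kernel.
rewrite ge0_integralZl//; last 2 first.
- exact: measurable_integral2.
- by move=> x _; apply: integral_ge0.
rewrite expr2 EFinM -muleA; apply: lee_wpmul2l => //.
rewrite fubini_tonelli// /sqint -ge0_integralZl//; last 2 first.
- exact: measurable_sqr.
- by move=> x _; rewrite lee_fin sqr_ge0.
rewrite le_eqVlt; apply/orP; left; apply/eqP; apply: eq_integral => y _.
rewrite /F/=; under eq_integral do rewrite EFinM.
have mKy : measurable_fun [set: R] (fun x => K (x - y)).
  by apply: (measurableT_comp mK); exact: measurable_funB.
rewrite ge0_integralZr//; last 2 first.
- by apply/measurable_EFinP; exact: measurableT_comp.
- by rewrite lee_fin sqr_ge0.
congr (_ * _)%E; rewrite -kE [RHS](ge0_integral_affine 1 (- y)) ?oner_eq0//; last first.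
  by apply/measurable_EFinP; exact: measurableT_comp.
by rewrite normr1 mul1e; apply: eq_integral => x _; rewrite mul1r.
Qed.

(** The square of A is integrable, hence almost everywhere finite. *)
Let A_fin w : measurable_fun [set: R] w -> (sqint w < +oo)%E ->
  {ae mu, forall x, (A w x < +oo)%E}.
Proof.
move=> mw woo.
have iA2 : mu.-integrable setT (fun x => A w x `^ 2)%E.
  apply/integrableP; split; first exact: mA2.
  under eq_integral do rewrite gee0_abs ?poweR_ge0//.
  apply: le_lt_trans (young_abs w mw) _.
  by rewrite lte_mul_pinfty// lee_fin sqr_ge0.
have := integrable_ae measurableT iA2; apply: filterS => x /(_ I).
have := A0 w x; case: (A w x) => [r _ _|_|//]; first exact: ltry.
by rewrite poweRE pnatr_eq0.
Qed.

(** Young's inequality for a difference of convolutions.  The two integrals can be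
    subtracted only where both converge absolutely, which by the inequality itself
    holds almost everywhere. *)
Lemma young_convolution (w1 w2 : R -> R) (c : R) :
  measurable_fun [set: R] w1 -> (sqint w1 < +oo)%E ->
  measurable_fun [set: R] w2 -> (sqint w2 < +oo)%E ->
  measurable_fun [set: R] (fun x => c * convolution K w1 x) ->
  measurable_fun [set: R] (fun x => c * convolution K w2 x) ->
  (sqint (fun x => c * convolution K w1 x - c * convolution K w2 x)%R <=
   ((c * k) ^+ 2)%:E * sqint (fun y => w1 y - w2 y)%R)%E.
Proof.
move=> mw1 w1oo mw2 w2oo mc1 mc2.
have mw : measurable_fun [set: R] (fun y => w1 y - w2 y) by exact: measurable_funB.
apply: (@le_trans _ _ (\int[mu]_x ((c ^+ 2)%:E * A (fun y => w1 y - w2 y)%R x `^ 2))%E);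
  last first.
  rewrite ge0_integralZl//; last 3 first.
  - exact: mA2.
  - by move=> x _; exact: poweR_ge0.
  - by rewrite lee_fin sqr_ge0.
  rewrite exprMn (EFinM (c ^+ 2)) -muleA; apply: lee_wpmul2l; first by rewrite lee_fin sqr_ge0.
  exact: young_abs.
apply: ae_ge0_le_integral => //.
- by move=> x _; rewrite lee_fin sqr_ge0.
- by apply: measurable_sqr; exact: measurable_funB.
- by move=> x _; rewrite mule_ge0 ?poweR_ge0// lee_fin sqr_ge0.
- by apply: measurable_funeM; exact: mA2.
- apply: (ae_imply2 _ _ _ _ (A_fin w1 mw1 w1oo) (A_fin w2 mw2 w2oo)).
  move=> x f1 f2 _.
  have mKx : measurable_fun [set: R] (fun y => K (x - y)).
    by apply: (measurableT_comp mK); exact: measurable_funB.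
  have int w : measurable_fun [set: R] w -> (A w x < +oo)%E ->
      mu.-integrable setT (EFin \o (fun y => K (x - y) * w y)).
    move=> mw' fw; apply/integrableP; split.
      by apply/measurable_EFinP; exact: measurable_funM.
    by under eq_integral do rewrite /= normrM.
  have i1 := int _ mw1 f1; have i2 := int _ mw2 f2.
  have -> : c * convolution K w1 x - c * convolution K w2 x =
      c * \int[mu]_y (K (x - y) * (w1 y - w2 y)).
    rewrite -mulrBr /convolution -RintegralB//; congr (c * _).
    by apply: eq_Rintegral => y _; rewrite mulrBr.
  have i12 : mu.-integrable setT (EFin \o (fun y => K (x - y) * (w1 y - w2 y))).
    by have := integrableB measurableT i1 i2; apply: eq_integrable => // y _ /=;
      rewrite -EFinB mulrBr.
  have le1 : ((`|\int[mu]_y (K (x - y) * (w1 y - w2 y))|)%:E <= A (fun y => w1 y - w2 y)%R x)%E.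
    rewrite EFin_normr_Rintegral//;
      apply: le_trans (le_abse_integral _ _ (measurable_int _ i12)) _ => //.
    by rewrite le_eqVlt; apply/orP; left; apply/eqP; apply: eq_integral => y _; rewrite /= normrM.
  rewrite exprMn (EFinM (c ^+ 2)); apply: lee_wpmul2l; first by rewrite lee_fin sqr_ge0.
  rewrite -real_normK ?num_real// -powR_mulrn// -poweR_EFin.
  by apply: gt0_ler_poweR => //; exact: mem_itv0y.
Qed.

End young.

(** * Functions with an essentially bounded derivative *)

Section lipschitz.
Context {R : realType}.
Notation mu := (@lebesgue_measure R).

Lemma norm_Lpoo_ae (D : R -> R) (B : R) : (norm_Lp +oo%E D <= B%:E)%E ->
  {ae mu, forall x, `|D x| <= B}.
Proof.
rewrite /norm_Lp unlock ifT.
  by move/ess_supP; apply: filterS => x /=; rewrite lee_fin.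
apply: (@lt_le_trans _ _ (mu (`[0, 1]%classic : set R))).
  by rewrite lebesgue_measure_itv/= lte_fin ltr01 oppr0 adde0 lte_fin.
by apply: le_measure => //; rewrite inE.
Qed.

Lemma integral_ess_bound (D : R -> R) (B t s : R) : measurable_fun [set: R] D ->
  (norm_Lp +oo%E D <= B%:E)%E -> t <= s ->
  mu.-integrable `[t, s] (EFin \o D) /\ `|\int[mu]_(z in `[t, s]) D z| <= B * (s - t).
Proof.
move=> mD DB ts.
have mDts : measurable_fun (`[t, s]%classic : set R) (EFin \o D).
  by apply/measurable_EFinP; exact: measurable_funTS.
have B0 : 0 <= B by rewrite -lee_fin; apply: le_trans DB; exact: norm_Lp_ge0.
have bound : (\int[mu]_(z in `[t, s]) `|(D z)%:E| <= (B * (s - t))%:E)%E.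
  apply: (@le_trans _ _ (\int[mu]_(z in `[t, s]) (cst B%:E) z)%E).
    apply: ae_ge0_le_integral => //.
    - exact: measurableT_comp.
    - apply: (ae_imply _ _ _ (norm_Lpoo_ae D B DB)) => x h _; by rewrite lee_fin.
  rewrite integral_cst//= lebesgue_measure_itv/= lte_fin.
  case: ifP => [_|]; first by rewrite -EFinB -EFinM.
  by move=> _; rewrite mule0 lee_fin mulr_ge0// subr_ge0.
have iD : mu.-integrable `[t, s] (EFin \o D).
  by apply/integrableP; split => //; apply: le_lt_trans bound (ltry _).
split => //; rewrite -lee_fin EFin_normr_Rintegral//.
by apply: le_trans bound; exact: le_abse_integral.
Qed.

Lemma bounded_derivativeP (g : R -> R) : bounded_derivative g ->
  measurable_fun [set: R] (derive1 g) /\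
  forall t s, t <= s -> mu.-integrable `[t, s] (EFin \o derive1 g).
Proof.
move=> [_ + _]; rewrite inE => /andP[]; rewrite !inE/= => mg.
rewrite /finite_norm -/(norm_Lp _ _) => goo; split => // t s ts.
have hB : (norm_Lp +oo%E (derive1 g) <= (fine (norm_Lp +oo%E (derive1 g)))%:E)%E.
  by rewrite fineK// ge0_fin_numE ?norm_Lp_ge0.
exact: (integral_ess_bound _ _ t s mg hB ts).1.
Qed.

Lemma bounded_derivative_lipschitzB (g1 g2 : R -> R) (B : R) :
  bounded_derivative g1 -> bounded_derivative g2 ->
  (norm_Lp +oo%E (fun z => derive1 g1 z - derive1 g2 z)%R <= B%:E)%E ->
  forall t s, `|(g1 s - g2 s) - (g1 t - g2 t)| <= B * `|s - t|.
Proof.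
move=> b1 b2 h.
have [m1 i1] := bounded_derivativeP g1 b1.
have [m2 i2] := bounded_derivativeP g2 b2.
have [_ _ f1] := b1; have [_ _ f2] := b2.
have key t s : t <= s -> `|(g1 s - g2 s) - (g1 t - g2 t)| <= B * (s - t).
  move=> ts; have -> : (g1 s - g2 s) - (g1 t - g2 t) = (g1 s - g1 t) - (g2 s - g2 t) by ring.
  rewrite f1// f2// -RintegralB//; [|exact: i1|exact: i2].
  by apply: (integral_ess_bound _ B t s _ h ts).2; exact: measurable_funB.
move=> t s; have [ts|st] := leP t s; first by rewrite [`|s - t|]ger0_norm ?subr_ge0//; exact: key.
rewrite distrC (distrC s) [`|t - s|]ger0_norm ?subr_ge0 ?(ltW st)//; exact: key (ltW st).
Qed.

Lemma bounded_derivative_lipschitz (g : R -> R) (B : R) : bounded_derivative g ->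
  (norm_Lp +oo%E (derive1 g) <= B%:E)%E ->
  forall t s, `|g s - g t| <= B * `|s - t|.
Proof.
move=> b h; have [m i] := bounded_derivativeP g b; have [_ _ f] := b.
have key t s : t <= s -> `|g s - g t| <= B * (s - t).
  by move=> ts; rewrite f//; exact: (integral_ess_bound _ B t s m h ts).2.
move=> t s; have [ts|st] := leP t s; first by rewrite [`|s - t|]ger0_norm ?subr_ge0//; exact: key.
rewrite distrC (distrC s) [`|t - s|]ger0_norm ?subr_ge0 ?(ltW st)//; exact: key (ltW st).
Qed.

Lemma lipschitz_continuous (g : R -> R) (B : R) :
  (forall t s, `|g s - g t| <= B * `|s - t|) -> continuous g.
Proof.
move=> h x; apply/cvgrPdist_le => e e0; near=> y.
rewrite (le_trans (h _ _))//.
have B1 : B <= `|B| + 1 by rewrite (le_trans (ler_norm B))// lerDl.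
have B0 : 0 < `|B| + 1 by rewrite ltr_wpDl.
rewrite (le_trans (ler_wpM2r _ B1))// mulrC -ler_pdivlMr//.
by near: y; apply: cvgr_dist_le; [exact: cvg_id|rewrite divr_gt0].
Unshelve. all: by end_near. Qed.

End lipschitz.

(** * Stability of the linear equation *)

Section solutions.
Context {R : realType}.
Notation mu := (@lebesgue_measure R).
Local Open Scope complex_scope.

Lemma is_fourier_pair (u : R -> R) psi : is_fourier u psi -> fourier_pair u psi.
Proof.
by move=> [/Lp2P[mU uoo] [/Lp2P[mr _] /Lp2P[mi _]] h].
Qed.

Lemma cmodM (z w : R[i]) : cmod (z * w) = cmod z * cmod w.
Proof. exact: ComplexField.Normc.normcM. Qed.

Lemma cmod_ge0 (z : R[i]) : 0 <= cmod z.
Proof. by case: z => x y; rewrite /cmod/= sqrtr_ge0. Qed.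

Lemma ae_neq0 : {ae mu, forall p : R, p != 0}.
Proof.
exists [set 0]; split => //; first exact: lebesgue_measure_set1.
by move=> p /= /negP; rewrite negbK => /eqP.
Qed.

(** By Plancherel on both sides, from C |psi| <= |symbol psi|. *)
Lemma solution_stability (a b C : R) (h1 h2 v1 v2 : R -> R) :
  0 < C -> (forall p : R, p != 0 -> C <= cmod (symbol a b p)) ->
  is_solution a b h1 v1 -> is_solution a b h2 v2 ->
  (norm_Lp 2%:E (fun x => v1 x - v2 x)%R <= C^-1%:E * norm_Lp 2%:E (fun x => h1 x - h2 x)%R)%E.
Proof.
move=> C0 hC [_ _ [vh1 [hh1 [/is_fourier_pair p1 /is_fourier_pair q1 s1]]]].
move=> [_ _ [vh2 [hh2 [/is_fourier_pair p2 /is_fourier_pair q2 s2]]]].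
have p := fourier_pairB _ _ _ _ p1 p2; have q := fourier_pairB _ _ _ _ q1 q2.
have [_ _ mp _] := p; have [_ _ mq _] := q.
apply: norm_Lp2_le; first by rewrite invr_ge0 ltW.
rewrite -(plancherel _ _ p) -(plancherel _ _ q).
rewrite /csqint -ge0_integralZl//; last 3 first.
- exact: measurable_cmod_sqr.
- by move=> x _; rewrite lee_fin sqr_ge0.
- by rewrite lee_fin sqr_ge0.
apply: ae_ge0_le_integral => //.
- by move=> x _; rewrite lee_fin sqr_ge0.
- exact: measurable_cmod_sqr.
- by move=> x _; rewrite mule_ge0 ?lee_fin ?sqr_ge0.
- by apply: measurable_funeM; exact: measurable_cmod_sqr.
- have s := ae_imply2 _ _ (fun p => symbol a b p * (vh1 p - vh2 p) = hh1 p - hh2 p) _ s1 s2.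
  apply: (ae_imply2 _ _ _ _ ae_neq0 (s _)).
    move=> x x0 e _; rewrite -e cmodM -EFinM lee_fin exprVn exprMn mulrA.
    rewrite ler_peMl ?sqr_ge0// mulrC ler_pdivlMr ?exprn_gt0// mul1r.
    by rewrite lerXn2r ?nnegrE ?cmod_ge0 ?(ltW C0)//; exact: hC.
  by move=> x e1 e2; rewrite mulrBr e1 e2.
Qed.

Lemma norm_Lp2_eq0 (u : R -> R) : measurable_fun [set: R] u ->
  norm_Lp 2%:E u = 0%E -> {ae mu, forall x, u x = 0}.
Proof.
move=> mU /Lnorm_eq0_eq0 h.
have /h : measurable_fun [set: R] (EFin \o u) by exact/measurable_EFinP.
have p0 : (0 < 2%:E :> \bar R)%E by rewrite lte_fin.
by move=> /(_ p0); apply: ae_imply => x /(_ I) [].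
Qed.

(** If u vanished, so would its Fourier transform, the transform of f, and f. *)
Lemma solution_neq0 (a b : R) (f u : R -> R) : is_solution a b f u ->
  ~ {ae mu, forall x, f x = 0} -> norm_Lp 2%:E u != 0%E.
Proof.
move=> [_ _ [uh [fh [/is_fourier_pair p /is_fourier_pair q s]]]] f0.
apply/eqP => u0; apply: f0.
have [mf foo mfh _] := q; have [_ _ muh _] := p.
apply: norm_Lp2_eq0 => //.
rewrite norm_Lp_sqint -(plancherel _ _ q).
suff -> : csqint fh = 0%E by rewrite poweR0r// invr_eq0.
have : csqint uh = 0%E by rewrite (plancherel _ _ p) sqint_poweR u0 poweR0r.
move=> cu.
have hu := (@ae_eq_integral_abs _ _ _ mu setT measurableT _ (measurable_cmod_sqr _ muh)).1.
have {}hu : {ae mu, forall x, setT x -> (cmod (uh x) ^+ 2)%:E = 0%E}.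
  apply: hu.
  by rewrite -[RHS]cu; apply: eq_integral => x _; rewrite gee0_abs// lee_fin sqr_ge0.
rewrite /csqint -(@integral0 _ _ _ mu setT).
apply: ae_eq_integral => //; first exact: measurable_cmod_sqr.
apply: (ae_imply2 _ _ _ _ s hu) => x <- /(_ I) /= [] e _.
by rewrite cmodM exprMn e mulr0.
Qed.

End solutions.

(** * Dependence of the fixed point on the nonlinearity *)

Theorem theorem4 (R : realType) (a b C M rho eps : R)
    (f K g1 g2 u0 up1 up2 : R -> R) :
  b != 0 ->
  f \in Lp 2%:E ->
  ~ {ae (@lebesgue_measure R), forall x, f x = 0} ->
  K \in Lp 1%E ->
  ~ {ae (@lebesgue_measure R), forall x, K x = 0} ->
  0 < M ->
  (exists s, g1 s != 0) -> g1 0 = 0 ->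
  bounded_derivative g1 -> (norm_Lp +oo%E (derive1 g1) <= M%:E)%E ->
  (exists s, g2 s != 0) -> g2 0 = 0 ->
  bounded_derivative g2 -> (norm_Lp +oo%E (derive1 g2) <= M%:E)%E ->
  0 < rho <= 1 ->
  0 < C -> (forall p : R, p != 0 -> C <= cmod (symbol a b p)) ->
  is_solution a b f u0 ->
  let normK : R := fine (norm_Lp 1%E K) in
  let normu0 : R := fine (norm_Lp 2%:E u0) in
  0 < eps <= rho * C / (M * normK * (normu0 + 1)) ->
  fixed_point_t a b eps rho K u0 g1 up1 ->
  fixed_point_t a b eps rho K u0 g2 up2 ->
  let u1 : R -> R := fun x => u0 x + up1 x in
  let u2 : R -> R := fun x => u0 x + up2 x in
  let sigma : R := eps * M * normK / C in
  (norm_Lp 2%:E (fun x => u1 x - u2 x)%R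
   <= (eps / (1 - sigma) * (normK / C) * (normu0 + 1))%:E
      * norm_Lp +oo%E (fun z => derive1 g1 z - derive1 g2 z)%R)%E.
Proof.
move=> _ _ f0 K1 _ M0 _ g10 bg1 g1M _ g20 bg2 g2M /andP[rho0 rho1] C0 hC su0 normK normu0.
move=> /andP[eps0 epsle] [[Lup1 up1rho] _ s1] [[Lup2 up2rho] _ s2].
pose u1 x := u0 x + up1 x; pose u2 x := u0 x + up2 x; pose sigma := eps * M * normK / C.
change (norm_Lp 2%:E (fun x => u1 x - u2 x)%R
   <= (eps / (1 - sigma) * (normK / C) * (normu0 + 1))%:E
      * norm_Lp +oo%E (fun z => derive1 g1 z - derive1 g2 z)%R)%E.
have iK : (@lebesgue_measure R).-integrable setT (EFin \o K) by exact/Lfun1_integrable.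
have normKE : normK = \int[@lebesgue_measure R]_y `|K y|.
  by rewrite /normK /norm_Lp Lnorm1.
have [Lu0 _ _] := su0.
have [mu0 u0oo] := Lp2P _ Lu0.
have [mup1 up1oo] := Lp2P _ Lup1.
have [mup2 up2oo] := Lp2P _ Lup2.
have fin v : v \in Lp 2%:E -> norm_Lp 2%:E v \is a fin_num.
  rewrite inE => /andP[_]; rewrite inE/= /finite_norm -/(norm_Lp _ _) => h.
  by rewrite ge0_fin_numE ?norm_Lp_ge0.
have normu0E : norm_Lp 2%:E u0 = normu0%:E by rewrite fineK// fin.
have normu0_gt0 : 0 < normu0.
  rewrite -lte_fin -normu0E lt0e norm_Lp_ge0 andbT.
  exact: (solution_neq0 _ _ _ _ su0 f0).
have normK_ge0 : 0 <= normK by rewrite normKE; exact: Rintegral_ge0.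
have normK_gt0 : 0 < normK.
  rewrite lt_def normK_ge0 andbT; apply: contraTneq (lt_le_trans eps0 epsle) => ->.
  by rewrite mulr0 mul0r invr0 mulr0 ltxx.
have sigma_lt1 : sigma < 1.
  rewrite /sigma ltr_pdivrMr// mul1r.
  have dpos : 0 < M * normK * (normu0 + 1) by rewrite !mulr_gt0// addr_gt0.
  move: epsle; rewrite ler_pdivlMr// => epsle.
  have e1 : eps * M * normK * (normu0 + 1) <= C.
    rewrite -!mulrA mulrA -!mulrA in epsle *.
    by rewrite (le_trans epsle)// ler_piMl// ltW.
  apply: lt_le_trans e1; rewrite ltr_pMr ?ltrDr//.
  by rewrite !mulr_gt0.
set G := norm_Lp +oo%E _.
have coef_gt0 : 0 < eps / (1 - sigma) * (normK / C) * (normu0 + 1).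
  by rewrite !mulr_gt0 ?invr_gt0 ?subr_gt0// addr_gt0.
have G0 : (0 <= G)%E by exact: norm_Lp_ge0.
(* If G is infinite the right-hand side is, because its coefficient is positive. *)
case: (eqVneq G +oo%E) => [->|Goo]; first by rewrite gt0_muley ?lte_fin// leey.
have GE : G = (fine G)%:E by rewrite fineK// fin_num_abs gee0_abs// ltey.
rewrite GE -EFinM.
have L1 := bounded_derivative_lipschitz g1 M bg1 g1M.
have L2 := bounded_derivative_lipschitz g2 M bg2 g2M.
have L12 : forall t s, `|(g1 s - g2 s) - (g1 t - g2 t)| <= fine G * `|s - t|.
  by apply: bounded_derivative_lipschitzB => //; rewrite -GE.
pose w1 y := g1 (u0 y + up1 y); pose w2 y := g2 (u0 y + up2 y).
have mu1 : measurable_fun [set: R] u1 by exact: measurable_funD.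
have mu2 : measurable_fun [set: R] u2 by exact: measurable_funD.
have mup : measurable_fun [set: R] (fun x => up1 x - up2 x) by exact: measurable_funB.
have triangle u v : measurable_fun [set: R] u -> measurable_fun [set: R] v ->
    (sqint u < +oo)%E -> (sqint v < +oo)%E -> (sqint (fun x => u x + v x)%R < +oo)%E.
  move=> mU mV uoo voo.
  apply: le_lt_trans (sqint_leD u v _ mU mV (measurable_funD mU mV) _) _ => //.
  by rewrite lte_add_pinfty// lte_mul_pinfty.
have u1oo := triangle _ _ mu0 mup1 u0oo up1oo.
have u2oo := triangle _ _ mu0 mup2 u0oo up2oo.
have mw1 : measurable_fun [set: R] w1.
  by apply: (measurableT_comp _ mu1); apply: continuous_measurable_fun;
    exact: lipschitz_continuous L1.
have mw2 : measurable_fun [set: R] w2.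
  by apply: (measurableT_comp _ mu2); apply: continuous_measurable_fun;
    exact: lipschitz_continuous L2.
have w1oo : (sqint w1 < +oo)%E.
  apply: le_lt_trans (sqint_scale w1 u1 M mw1 mu1 _) _.
    by move=> x; have := L1 0 (u1 x); rewrite g10 !subr0.
  by rewrite lte_mul_pinfty// lee_fin sqr_ge0.
have w2oo : (sqint w2 < +oo)%E.
  apply: le_lt_trans (sqint_scale w2 u2 M mw2 mu2 _) _.
    by move=> x; have := L2 0 (u2 x); rewrite g20 !subr0.
  by rewrite lte_mul_pinfty// lee_fin sqr_ge0.
have E12 : (fun x => u1 x - u2 x) = (fun x => up1 x - up2 x).
  by apply/funext => x; rewrite /u1 /u2; ring.
have bound1 := solution_stability a b C _ _ _ _ C0 hC s1 s2.
have [_ /Lp2P[mh1 _] _] := s1; have [_ /Lp2P[mh2 _] _] := s2.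
have bound2 := young_convolution K iK w1 w2 eps mw1 w1oo mw2 w2oo mh1 mh2.
rewrite -normKE in bound2.
have {}bound2 := norm_Lp2_le _ _ (eps * normK) (ltW (mulr_gt0 eps0 normK_gt0)) bound2.
have Gr0 : 0 <= fine G by rewrite fine_ge0.
(* Change the argument of g1 first, then g1 into g2; the increment of g1 - g2 is
   taken from the origin, where it vanishes. *)
have bound3 : (norm_Lp 2%:E (fun y => w1 y - w2 y)%R <=
    M%:E * norm_Lp 2%:E (fun x => up1 x - up2 x)%R + (fine G)%:E * norm_Lp 2%:E u2)%E.
  apply: norm_Lp2_lin => //; [exact: ltW|exact: measurable_funB|].
  move=> x; have := L1 (u2 x) (u1 x); have := L12 0 (u2 x).
  rewrite g10 g20 !subr0 => d12 d1.
  have -> : w1 x - w2 x = (g1 (u1 x) - g1 (u2 x)) + (g1 (u2 x) - g2 (u2 x)) by rewrite /w1 /w2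
    /u1 /u2; ring.
  rewrite (le_trans (ler_normD _ _))// lerD//.
  by rewrite (_ : up1 x - up2 x = u1 x - u2 x)// /u1 /u2; ring.
have bound4 : (norm_Lp 2%:E u2 <= (normu0 + 1)%:E)%E.
  apply: (@le_trans _ _ (1%:E * norm_Lp 2%:E u0 + 1%:E * norm_Lp 2%:E up2)%E).
    by apply: norm_Lp2_lin => // x; rewrite !mul1r; exact: ler_normD.
  rewrite !mul1e normu0E (EFinD normu0); apply: leeD => //.
  by apply: (le_trans up2rho); rewrite lee_fin.
have Dfin : norm_Lp 2%:E (fun x => up1 x - up2 x)%R \is a fin_num.
  rewrite ge0_fin_numE ?norm_Lp_ge0//.
  apply: (@le_lt_trans _ _ (1%:E * norm_Lp 2%:E up1 + 1%:E * norm_Lp 2%:E up2)%E).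
    by apply: norm_Lp2_lin => // x; rewrite !mul1r; exact: ler_normB.
  by rewrite !mul1e lte_add_pinfty// -ge0_fin_numE ?norm_Lp_ge0// fin.
rewrite E12.
set D := norm_Lp 2%:E _ in Dfin bound1 bound3 *.
have DE : D = (fine D)%:E by rewrite fineK.
have : (D <= (C^-1 * (eps * normK * (M * fine D + fine G * (normu0 + 1))))%:E)%E.
  apply: (le_trans bound1); rewrite (EFinM C^-1); apply: lee_wpmul2l;
    first by rewrite lee_fin invr_ge0 ltW.
  apply: (le_trans bound2); rewrite (EFinM (eps * normK)); apply: lee_wpmul2l;
    first by rewrite lee_fin mulr_ge0// ltW.
  apply: (le_trans bound3); rewrite (EFinD (M * fine D)) [X in (_ <= X + _)%E]EFinM -DE;
    apply: leeD => //.
  by rewrite (EFinM (fine G)); apply: lee_wpmul2l.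
rewrite DE !lee_fin => h.
have s1' : 0 < 1 - sigma by rewrite subr_gt0.
have -> : eps / (1 - sigma) * (normK / C) * (normu0 + 1) * fine G =
   (eps * normK / C * (normu0 + 1) * fine G) / (1 - sigma).
  by field; rewrite !gt_eqF.
rewrite ler_pdivlMr// mulrBr mulr1 lerBlDr (le_trans h)// le_eqVlt; apply/orP; left; apply/eqP.
by rewrite /sigma; field; rewrite gt_eqF.
Qed.
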